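(* Let $V:\mathbb{R}^n\to\mathbb{R}$ be a function. Then $V_t$ converges to $V$ uniformly on $\Omega=\mathbb{R}^n$ as $t\to+\infty$ if and only if $V_\lambda$ converges to $V$ uniformly on $\Omega=\mathbb{R}^n$ as $\lambda\to 0^+$.
   Context: Let $U$ be a nonempty metric space and let $f:\mathbb{R}^n\times U\to\mathbb{R}^n$ be Lipschitz with respect to the state variable (there is $L\ge 0$ with $\|f(y,u)-f(y',u)\|\le L\|y-y'\|$ for all $y,y'\in\mathbb{R}^n$, $u\in U$), continuous with respect to the control variable $u$, and bounded by a linear function of the state variable (there is $C\ge 0$ with $\|f(y,u)\|\le C(1+\|y\|)$ for all $y\in\mathbb{R}^n$, $u\in U$). Let $\mathcal{U}$ be the set of Lebesgue-measurable functions $u:\mathbb{R}_+\to U$. For $y_0\in\mathbb{R}^n$ and $u\in\mathcal{U}$, let $s\mapsto y(s,u,y_0)$ denote the solution on $\mathbb{R}_+$ (absolutely continuous on bounded intervals, equation holding for almost every $s$) of $y'(s)=f(y(s),u(s))$, $y(0)=y_0$. Let $g:\mathbb{R}^n\times U\to[0,1]$ be Borel-measurable. For $t>0$ and $\lambda>0$ define $$V_t(y_0)=\inf_{u\in\mathcal{U}}\frac1t\int_0^t g(y(s,u,y_0),u(s))\,ds,\qquad V_\lambda(y_0)=\inf_{u\in\mathcal{U}}\lambda\int_0^{+\infty}e^{-\lambda s}g(y(s,u,y_0),u(s))\,ds .$$ The subscript $t$ always denotes the finite-horizon value and the subscript $\lambda$ the discounted value. *)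

(* Defs.v *)
From HB Require Import structures.
From mathcomp Require Import all_boot all_order all_algebra.
From mathcomp Require Import all_classical all_reals all_analysis.

Set Implicit Arguments.
Unset Strict Implicit.
Unset Printing Implicit Defensive.

Import Order.TTheory GRing.Theory Num.Theory.
Import numFieldNormedType.Exports.

Local Open Scope classical_set_scope.
Local Open Scope ring_scope.

(* R^n is ['rV[R]_n] with the library's norm, which is the sup norm; norms on
   R^n being equivalent, the existence of the constants L and C below, absolute
   continuity and derivatives do not depend on this choice. *)

(* The real line with the sigma-algebra of Lebesgue-measurable sets, the one on
   which [completed_lebesgue_measure] is defined ([measurable] at the plain
   type [R] means Borel). *)
Definition lebesgue_line (R : realType) : measurableType _ :=
  caratheodory_type (((wlength (@idfun R))^*)%mu).

Definition borel_set (T : topologicalType) : set (set T) := <<s @open T >>.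

(* The library's [g_sigma_algebraType] needs a pointed carrier, which neither U
   nor R^n * U is, so Borel measurability is spelled out with preimages. *)
Definition borel_measurable (T T' : topologicalType) (h : T -> T') : Prop :=
  forall A : set T', borel_set A -> borel_set (h @^-1` A).

Section AbsoluteContinuity.
Context {R : realType} {V : normedModType R}.

Definition absolutely_continuous (a b : R) (y : R -> V) : Prop :=
  forall e : R, 0 < e -> exists2 d : R, 0 < d &
    forall (N : nat) (p q : 'I_N -> R),
      (forall i, [/\ a <= p i, p i <= q i & q i <= b]) ->
      trivIset [set: 'I_N] (fun i => `]p i, q i[%classic) ->
      \sum_(i < N) (q i - p i) < d ->
      \sum_(i < N) `|y (q i) - y (p i)| < e.

End AbsoluteContinuity.

Section ControlSystem.
Context {R : realType} {n : nat} {U : metricType R}.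
Implicit Types (f : 'rV[R]_n -> U -> 'rV[R]_n) (g : 'rV[R]_n * U -> R).
Implicit Types (u : R -> U).

Definition state_lipschitz f : Prop :=
  exists2 L : R, 0 <= L &
    forall (y y' : 'rV[R]_n) (v : U), `|f y v - f y' v| <= L * `|y - y'|.

Definition linear_growth f : Prop :=
  exists2 C : R, 0 <= C &
    forall (y : 'rV[R]_n) (v : U), `|f y v| <= C * (1 + `|y|).

(* A control is a function on R_+; it is represented by a function on R whose
   values at negative times are irrelevant. *)
Definition controls : set (R -> U) :=
  [set u | forall A : set U, borel_set A ->
     @measurable _ (lebesgue_line R) (`[0, +oo[ `&` u @^-1` A)].

(* Only the values of [y] on R_+ are constrained. *)
Definition is_solution f u (y0 : 'rV[R]_n) (y : R -> 'rV[R]_n) : Prop :=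
  [/\ y 0 = y0,
      forall T : R, 0 < T -> absolutely_continuous 0 T y &
      {ae (@completed_lebesgue_measure R), forall s : R,
         0 < s -> is_derive s 1 y (f (y s) (u s))}].

(* Under the standing assumptions on [f], a solution exists for every control
   and is unique on R_+; the default value of [xget] is then never used. *)
Definition trajectory f u (y0 : 'rV[R]_n) : R -> 'rV[R]_n :=
  xget (fun=> y0) [set y | is_solution f u y0 y].

Definition running_cost f g (y0 : 'rV[R]_n) u (s : R) : R :=
  g (trajectory f u y0 s, u s).

Definition value_horizon f g (t : R) (y0 : 'rV[R]_n) : R :=
  inf [set t^-1 * \int[@completed_lebesgue_measure R]_(s in `[0, t])
                    running_cost f g y0 u s | u in controls].

Definition value_discounted f g (lambda : R) (y0 : 'rV[R]_n) : R :=
  inf [set lambda * \int[@completed_lebesgue_measure R]_(s in `[0, +oo[)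
                      (expR (- lambda * s) * running_cost f g y0 u s)
      | u in controls].

End ControlSystem.

(* Main.v *)
Require Import Defs.
From HB Require Import structures.
From mathcomp Require Import all_boot all_order all_algebra.
From mathcomp Require Import all_classical all_reals all_analysis.
From mathcomp Require Import measurable_realfun ring lra.

Set Implicit Arguments.
Unset Strict Implicit.
Unset Printing Implicit Defensive.

Import Order.TTheory GRing.Theory Num.Theory.
Import numFieldNormedType.Exports.

Local Open Scope classical_set_scope.
Local Open Scope ring_scope.

(** A control enters both value functions only through its cost rate, the
    function h(s) = g(y(s), u(s)) of time, and only one property of the set H(y)
    of the cost rates issued from a state y matters ([costs_splice]): if h is in
    H(y) and s >= 0, there is a state y' (the one reached at time s) such that the
    shifted rate h(s + .) is in H(y'), and following h up to time s and then any
    rate of H(y') gives a rate of H(y). The equivalence of the two limits is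
    proved for all such families.

    Write G(t) for the integral of h over [0, t] and D(l) for the discounted cost
    of h. In both directions the limit V does not decrease along trajectories:
    reaching y' from y takes a bounded time, which weighs nothing in the limit, so
    V(y) <= V(y'). Costs are transferred by two tools:
    - D(l) is an average of G with an explicit kernel, so a bound
      G(s) <= a + b s + c s^2 for all s >= 0 yields D(l) <= a l + b + 2 c / l
      ([discounted_le_poly]), and dually for affine lower bounds;
    - cutting at time t, D(l) is l times the discounted cost before t plus
      exp(- l t) times the discounted cost of the shifted rate
      ([discounted_split]).

    From horizons to discounts ([horizon_uniform_discount]). G(s) >= (V - e) s for
    large s bounds all discounted costs from below. Conversely take h almost
    optimal for the horizon t. Since V does not decrease along the trajectory, the
    part of h after s costs at least about (t - s) V, so G(s) cannot exceed s V by
    more than a small fraction of t for any s <= t; with t a large multiple of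
    1 / l the discounted cost is then close to V.

    From discounts to horizons ([discount_uniform_horizon]). An h almost optimal
    for the rate l has a nearly optimal average over [0, t] when l t is small:
    what follows t costs at least V again, and the weights are almost constant
    before t. Conversely, if G(t) < (V - e) t, start from a point s where
    G(s) - (V - e / 2) s is almost maximal: from there on all the averages of the
    cost stay below about V - e / 2 during a time of order e t, so for a rate l of
    order 1 / t the discounted cost from the state y' reached at s is smaller than
    V(y) by a fixed amount, contradicting V(y) <= V(y').

    The splicing property requires that trajectories exist, are unique, and can
    be concatenated. Existence is Picard iteration for the integral equation
    ([integral_equation_solvable]), followed by almost everywhere differentiation
    of integrals. Uniqueness among absolutely continuous solutions rests on a
    monotonicity criterion ([absolutely_continuous_nonincreasing]) applied to
    exp(- L t) |y1(t) - y2(t)|. Measurability of the cost rates holds because R^n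
    has a countable basis, although U need not have one
    ([measurable_line_state_control]). *)


(** * Lebesgue measure on the line: translations and Borel versions *)

Section LebesgueLine.
Context {R : realType}.
Local Notation mu := (@completed_lebesgue_measure R).
Local Notation line := (lebesgue_line R).
Local Notation outer := (((wlength (@idfun R))^*)%mu).

(** A cover of [A] by intervals translates into a cover of the translate of [A]
    by intervals of the same lengths. *)
Lemma lebesgue_outer_translate_le (c : R) (A : set R) :
  (outer ((fun x : R => x + c)%R @^-1` A) <= outer A)%E.
Proof.
rewrite /mu_ext; apply: le_ereal_inf_tmp => _ [F [mF AF] <-].
apply: ereal_inf_lbound => /=.
have shiftF k : exists2 G : set R, ocitv G &
   G = (fun x => x + c) @^-1` F k /\ wlength (@idfun R) G = wlength (@idfun R) (F k).
  have [[a b] /= ab Fk] := mF k.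
  have EG : (fun x => x + c) @^-1` F k = `]a - c, b - c]%classic.
    by rewrite -Fk; apply/seteqP; split => x /=; rewrite !in_itv/= lerBrDr ltrBlDr.
  exists ((fun x => x + c) @^-1` F k); first by rewrite EG; exists (a - c, b - c).
  split => //; rewrite EG -Fk !wlength_itv /= !lte_fin ltrD2r.
  by case: ifP => // _; rewrite -!EFinB opprB addrA subrK.
exists (fun k => (fun x => x + c) @^-1` F k).
  split=> [k|x /AF [k _ Fkx]]; last by exists k.
  by have [G ? [<- _]] := shiftF k.
by apply: eq_eseriesr => k _; have [G ? [<- ->]] := shiftF k.
Qed.

Lemma lebesgue_outer_translate (c : R) (A : set R) :
  outer ((fun x => x + c) @^-1` A) =
   outer A.
Proof.
apply/eqP; rewrite eq_le lebesgue_outer_translate_le/=.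
rewrite -[in leLHS](_ : (fun x => x + - c) @^-1` ((fun x => x + c) @^-1` A) = A).
  exact: lebesgue_outer_translate_le.
by apply/seteqP; split => x /=; rewrite subrK.
Qed.

(** Caratheodory's condition only involves the outer measure, which is invariant
    under translation. *)
Lemma measurable_translate (c : R) (A : set line) :
  measurable A -> measurable ((fun x : R => x + c) @^-1` A : set line).
Proof.
move=> mA; change (outer.-caratheodory ((fun x : R => x + c) @^-1` A)) => X.
rewrite -(lebesgue_outer_translate (- c) X).
have /= -> : (outer ((fun x : R => (x - c)%R) @^-1` X) =
    outer ((fun x : R => (x - c)%R) @^-1` X `&` A) +
    outer ((fun x : R => (x - c)%R) @^-1` X `&` ~` A))%E by exact: mA.
rewrite -(lebesgue_outer_translate c (_ `&` A)).
rewrite -(lebesgue_outer_translate c (_ `&` ~` A)).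
by congr (outer _ + outer _)%E; apply/seteqP; split => x /=; rewrite addrK.
Qed.

Lemma negligible_translate (c : R) (A : set line) :
  mu.-negligible A -> mu.-negligible ((fun x : R => x + c) @^-1` A : set line).
Proof.
move=> [B [mB B0 AB]]; exists ((fun x : R => x + c) @^-1` B); split.
- exact: measurable_translate.
- exact: etrans (lebesgue_outer_translate c B) B0.
- by move=> x /AB.
Qed.

Lemma measurable_line_borel (A : set R) : measurable A -> @measurable _ line A.
Proof. exact: sub_caratheodory. Qed.

Lemma measurable_line_itv (i : interval R) : @measurable _ line [set` i].
Proof. by apply: measurable_line_borel; exact: measurable_itv. Qed.

Lemma ge0_Rintegral_translate (c : R) (D : set line) (h : line -> R) :
  measurable D -> measurable_fun D h -> (forall x, D x -> 0 <= h x) ->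
  \int[mu]_(x in (fun x : R => x + c) @^-1` D) h (x + c) = \int[mu]_(x in D) h x.
Proof.
move=> mD mh h0.
have mT : measurable_fun [set: line] (fun x : line => (x + c : line)).
  by move=> _ A mA; rewrite setTI; exact: measurable_translate.
congr fine.
have := @ge0_integral_pushforward _ _ _ _ R _ mT mu D (EFin \o h) mD.
move=> /(_ _ _)/= <-.
- apply: eq_measure_integral => A mA AD /=.
  exact: (lebesgue_outer_translate c A).
- exact/measurable_EFinP.
- by move=> y /set_mem Dy; rewrite lee_fin h0.
Qed.

(** The superlevel sets of [h] at rational levels are Borel up to null sets. These
    are countably many, so the union [M] of the null sets is null, and erasing [M]
    makes every superlevel set Borel. Results on Borel functions thus apply to
    Lebesgue-measurable ones. *)
Lemma borel_version (h : line -> R) : measurable_fun [set: line] h ->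
  exists M : set R, [/\ measurable M, lebesgue_measure M = 0%E &
    measurable_fun [set: R] (h \_ (~` M))].
Proof.
move=> mh.
have cut (q : rat) : exists BM : set R * set R,
    [/\ measurable BM.1, measurable BM.2, lebesgue_measure BM.2 = 0%E &
      h @^-1` `[ratr q, +oo[ `\` BM.2 = BM.1 `\` BM.2].
  have : @measurable _ line (h @^-1` `[ratr q, +oo[).
    by rewrite -[X in measurable X]setTI; apply: mh => //; exact: measurable_itv.
  rewrite -[X in X _]completed_caratheodory_measurable g_sigma_completed_algebra_genE.
  move=> [B mB [N [M [mM M0 NM]]] BN].
  exists (B, M); split => //=; rewrite -BN.
  rewrite setDUl [X in _ `|` X](_ : _ = set0) ?setU0//.
  by rewrite setDE; apply/seteqP; split => x // [/NM ? []].
pose BM q := projT1 (cid (cut q)).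
have BMP q := projT2 (cid (cut q)).
pose N q := (BM q).2.
pose M := \bigcup_(n : nat) oapp N set0 (unpickle n).
have NM q : N q `<=` M.
  by move=> x Nx; exists (pickle q); [exact: Logic.I|rewrite pickleK].
have mM : measurable M.
  apply: bigcupT_measurable => n; case: (unpickle n) => [q|] //=.
  by have [] := BMP q.
have M0 : lebesgue_measure M = 0%E.
  apply: (iffLR (@negligibleP _ _ _ lebesgue_measure _ mM));
    apply: negligible_bigcup => n.
  case: (unpickle n) => [q|] /=; last exact: negligible_set0.
  by have [_ mN N0 _] := BMP q; apply/negligibleP.
exists M; split => //.
apply: (measurability _ (RGenOInfty.measurableE R)) => _ [_ [c ->] <-].
rewrite setTI.
have -> : (h \_ (~` M)) @^-1` `]c, +oo[ =
    \bigcup_(q : rat) (if c < ratr q then (BM q).1 `\` M else set0) `|`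
    (if c < 0 then M else set0).
  apply/seteqP; split => x /=.
    rewrite patchE in_itv/= andbT; case: ifPn => [xM|/negP].
      move=> /rat_in_itvoo[q]; rewrite in_itv/= => /andP[cq qh].
      left; exists q => //; rewrite cq; split; last exact/set_mem.
      have [_ _ _ /seteqP[/(_ x) + _]] := BMP q; rewrite /= in_itv/= andbT.
      case=> //; split; first exact: ltW.
      by move=> /NM; move/set_mem : xM.
    by rewrite inE => /contrapT Mx c0; right; rewrite c0.
  case=> [[q _]|]; last first.
    case: ifPn => // c0 Mx; rewrite patchE in_itv/= andbT.
    by case: ifPn => //; rewrite inE.
  case: ifPn => // cq [Bx Mx]; rewrite patchE in_itv/= andbT ifT ?inE//.
  apply: (lt_le_trans cq).
  have [_ _ _ /seteqP[_ /(_ x)]] := BMP q; rewrite /= in_itv/= andbT.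
  by case=> //; split => // /NM.
apply: measurableU; last by case: ifP.
apply: bigcupT_measurable_rat => q; case: ifP => // _.
by apply: measurableD => //; have [] := BMP q.
Qed.

End LebesgueLine.

(** * Integrals over intervals of the line *)

Section IntegralLine.
Context {R : realType}.
Local Notation mu := (@completed_lebesgue_measure R).
Local Notation line := (lebesgue_line R).
Implicit Types (h : line -> R) (a b c : R).

Lemma integrable_line_itv h a b (B : R) :
  measurable_fun (`[a, b] : set line) h ->
  (forall s, a <= s <= b -> `|h s| <= B) ->
  mu.-integrable `[a, b] (EFin \o h).
Proof.
move=> mh hB; apply: measurable_bounded_integrable => //.
- exact: measurable_line_itv.
- change (@lebesgue_measure R `[a, b]%classic < +oo)%E.
  by rewrite lebesgue_measure_itv /=; case: ifP => _; rewrite ltry.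
- exists B; split; first exact: num_real.
  move=> M BM s /= sab; apply: le_trans (ltW BM); apply: hB.
  by rewrite in_itv in sab.
Qed.

Lemma lebesgue_line_set1 a : mu [set a] = 0%E.
Proof. exact: lebesgue_measure_set1. Qed.

Lemma Rintegral_line_split h a b c : a <= b -> b <= c ->
  mu.-integrable `[a, c] (EFin \o h) ->
  \int[mu]_(s in `[a, c]) h s =
  \int[mu]_(s in `[a, b]) h s + \int[mu]_(s in `[b, c]) h s.
Proof.
move=> ab bc ih.
have mi (i : interval R) : @measurable _ line [set` i] := @measurable_line_itv R i.
have -> : (`[a, c]%classic : set line) = `[a, b]%classic `|` `]b, c]%classic.
  by rewrite -itv_bndbnd_setU// bnd_simp.
rewrite Rintegral_setU//.
- congr (_ + fine _); rewrite [RHS](@negligible_integral _ _ _ mu _ [set b])//.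
  + congr (integral mu _ _); apply/seteqP; split => s /=; rewrite !in_itv/=.
      by move=> /andP[bs ->]; split; [rewrite ltW|apply/eqP; rewrite gt_eqF].
    by move=> [/andP[bs ->] sb]; rewrite lt_neqAle bs !andbT; apply/eqP => /esym.
  + by rewrite -[X in measurable X]set_itv1; exact: mi.
  + apply: integrableS ih => //= s /=; rewrite !in_itv/= => /andP[bs ->].
    by rewrite (le_trans ab).
  + exact: lebesgue_line_set1.
- by rewrite -itv_bndbnd_setU// bnd_simp.
- apply/disj_setPS => s [/=]; rewrite !in_itv/= => /andP[_ sb] /andP[].
  by rewrite ltNge sb.
Qed.

Lemma Rintegral_line_cst a b (k : R) : a <= b ->
  \int[mu]_(s in `[a, b]) k = k * (b - a).
Proof.
move=> ab; rewrite Rintegral_cst; last exact: measurable_line_itv.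
congr (_ * _); change (fine (@lebesgue_measure R `[a, b]%classic) = b - a).
rewrite lebesgue_measure_itv/= lte_fin; by case: ltgtP ab => //= ->; rewrite subrr.
Qed.

Lemma Rintegral_line_bounds h a b (m M : R) : a <= b ->
  measurable_fun (`[a, b] : set line) h ->
  (forall s, a <= s <= b -> m <= h s <= M) ->
  m * (b - a) <= \int[mu]_(s in `[a, b]) h s <= M * (b - a).
Proof.
move=> ab mh hmM.
have ih : mu.-integrable `[a, b] (EFin \o h).
  apply: (@integrable_line_itv _ _ _ (`|m| + `|M|)) => // s /hmM /andP[h1 h2].
  have := ler_norm (- m); have := ler_norm M; have := normr_ge0 M; have := normr_ge0 m.
  by rewrite normrN ler_norml => *; apply/andP; split; lra.
have ic k : mu.-integrable `[a, b] (EFin \o cst k).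
  apply: (@integrable_line_itv _ _ _ `|k|) => //.
have mi : @measurable _ line `[a, b] := @measurable_line_itv R _.
apply/andP; split; rewrite -(Rintegral_line_cst _ ab); apply: le_Rintegral => //.
- exact: ic.
- by move=> s /=; rewrite in_itv/= => /hmM/andP[].
- exact: ic.
- by move=> s /=; rewrite in_itv/= => /hmM/andP[].
Qed.

Lemma measurable_line_id :
  measurable_fun [set: line] (fun x : line => (x : measurableTypeR R)).
Proof. by move=> _ A mA; rewrite setTI; exact: measurable_line_borel. Qed.

(** On Borel sets the Lebesgue measure is the image of its completion under the
    identity map. *)
Lemma ge0_integral_completed (D : set (measurableTypeR R))
    (h : measurableTypeR R -> \bar R) :
  measurable D -> measurable_fun D h -> (forall s, 0 <= h s)%E ->
  (\int[mu]_(s in D) h s = \int[lebesgue_measure]_(s in D) h s)%E.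
Proof.
move=> mD mh h0.
have := @ge0_integral_pushforward _ _ _ _ R _ measurable_line_id mu D h mD mh.
move=> /(_ (fun s _ => h0 s)) <-; apply: eq_measure_integral => [|*];
  first exact: measurable_line_id.
exact: erefl.
Qed.

Lemma integral_completed (D : set (measurableTypeR R))
    (h : measurableTypeR R -> \bar R) :
  measurable D -> measurable_fun [set: measurableTypeR R] h -> mu.-integrable D h ->
  (\int[mu]_(s in D) h s = \int[lebesgue_measure]_(s in D) h s)%E.
Proof.
move=> mD mh ih.
have := @integral_pushforward _ _ _ _ R _ measurable_line_id mu D h mh ih mD.
move=> <-; apply: eq_measure_integral => [|*]; first exact: measurable_line_id.
exact: erefl.
Qed.

Lemma measurable_expR_scaled (k : R) :
  measurable_fun [set: measurableTypeR R] (fun s : R => expR (k * s)).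
Proof.
apply: continuous_measurable_fun => s; apply: continuous_comp.
  exact: mulrl_continuous.
exact: continuous_expR.
Qed.

Lemma measurable_line_expR (k : R) :
  measurable_fun [set: line] (fun s : R => expR (k * s)).
Proof.
exact: (measurableT_comp (measurable_expR_scaled k) measurable_line_id).
Qed.

Lemma is_derive_exp_scaled (l s : R) :
  is_derive s (1 : R) (fun s => expR (- l * s)) (- l * expR (- l * s)).
Proof.
have -> : (fun s : R => expR (- l * s)) = expR \o (fun s : R => - l * s) by [].
by rewrite [X in is_derive _ _ _ X]mulrC; apply: is_derive1_comp; apply: is_derive_eq;
  rewrite /GRing.scale/= mulr1.
Qed.

Lemma integrable_line_expR (l a : R) : 0 < l ->
  mu.-integrable `[a, +oo[ (EFin \o (fun s => expR (- l * s))) /\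
  \int[mu]_(s in `[a, +oo[) expR (- l * s) = expR (- l * a) / l.
Proof.
move=> l0.
have dE (s : R) := is_derive_exp_scaled l s.
have cE : continuous (fun s : R => expR (- l * s)).
  by move=> s; apply: differentiable_continuous; exact/derivable1_diffP/ex_derive.
have mE := measurable_expR_scaled (- l).
have mi : @measurable _ line `[a, +oo[ := @measurable_line_itv R _.
have E : (\int[mu]_(s in `[a, +oo[) (expR (- l * s))%:E = (expR (- l * a) / l)%:E)%E.
  rewrite ge0_integral_completed.
  - pose F (s : R) := - l^-1 * (expR (- l * s)).
    have dF (s : R) : is_derive s (1 : R) F (expR (- l * s)).
      apply: is_derive_eq; rewrite /GRing.scale/= mulrA mulrNN mulVf ?mul1r ?gt_eqF//.
    have cF : continuous F.
      by move=> s; apply: differentiable_continuous; exact/derivable1_diffP/ex_derive.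
    rewrite (@ge0_continuous_FTC2y _ _ F a 0).
    + by rewrite sub0e /F -EFinN mulNr opprK mulrC.
    + by move=> s _; exact: expR_ge0.
    + exact/continuous_subspaceT.
    + rewrite -[0](mulr0 (- l^-1)); apply: cvgMr => //.
      under eq_fun do rewrite mulNr.
      have ly : (l * x) @[x --> +oo] --> +oo by apply: gt0_cvgMry.
      exact: (cvg_comp _ (fun x : R => expR (- x)) ly (@cvgr_expR R)).
    + by move=> s _; exact: ex_derive.
    + by apply: cvg_at_right_filter; exact: cF.
    + by move=> s _; rewrite derive1E; exact: derive_val.
  - exact: measurable_itv.
  - by apply/measurable_EFinP; exact: measurable_funTS.
  - by move=> y; rewrite lee_fin expR_ge0.
split; last by rewrite /Rintegral E.
apply/integrableP; split.
  apply/measurable_EFinP; apply: measurable_funTS.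
  exact: measurable_line_expR.
under eq_integral => s _ do rewrite /= ger0_norm ?expR_ge0//.
by rewrite E ltry.
Qed.

End IntegralLine.

(** * Absolutely continuous functions and one-sided derivatives *)

Section Growth.
Context {R : realType}.
Local Notation mu := (@completed_lebesgue_measure R).

(** The supremum of the times up to which [psi] stays below [psi a] satisfies the
    same bound by the first local condition, and cannot lie before [b] by the
    second one. *)
Lemma nonincreasing_of_local (psi : R -> R) (a b : R) : a <= b ->
  (forall t, a < t <= b -> forall eta, 0 < eta ->
     exists2 d, 0 < d & forall s, a <= s -> t - d < s -> s < t ->
       psi t <= psi s + eta) ->
  (forall t, a <= t < b -> exists2 d, 0 < d &
     forall s, t < s -> s < t + d -> s <= b -> psi s <= psi t) ->
  psi b <= psi a.
Proof.
move=> ab lsc step.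
pose S := [set t | a <= t <= b /\ psi t <= psi a].
have Sa : S a by split; rewrite lexx.
have supS : has_sup S.
  by split; [exists a|exists b => t [/andP[]]].
have am : a <= sup S by apply: ub_le_sup => //; case: supS.
have mb : sup S <= b by apply: ge_sup; [exists a|move=> t [/andP[]]].
have Sm : S (sup S).
  split; first by rewrite am.
  have [<-//|am'] := eqVneq a (sup S).
  apply/ler_addgt0Pr => eta eta0.
  have [|d d0 dP] := lsc (sup S) _ eta eta0; first by rewrite lt_neqAle am' am.
  have [t St tm] := sup_adherent d0 supS.
  have [/andP[ta tb] tv] := St.
  have tle : t <= sup S by apply: ub_le_sup => //; case: supS.
  have [tE|tm'] := eqVneq t (sup S); first by rewrite -tE; lra.
  by have := dP t ta tm; rewrite lt_neqAle tm' tle => /(_ isT); lra.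
have [bm|mb'] := eqVneq (sup S) b; first by case: Sm; rewrite bm.
have mltb : sup S < b by rewrite lt_neqAle mb' mb.
have [|d d0 dP] := step (sup S); first by rewrite am.
pose s := Num.min b (sup S + d / 2).
have ms : sup S < s by rewrite lt_min mltb ltrDl divr_gt0.
have sb : s <= b by rewrite ge_min lexx.
have sd : s < sup S + d by rewrite gt_min; apply/orP; right; rewrite ltrD2l; lra.
have Ss : S s.
  by split; [rewrite sb andbT (le_trans am)// ltW|have := dP s ms sd sb; case: Sm; lra].
suff : s <= sup S by rewrite leNgt ms.
by apply: ub_le_sup => //; case: supS.
Qed.

Definition interval_family (a b : R) (N : nat) (p q : 'I_N -> R) : Prop :=
  (forall i, [/\ a <= p i, p i <= q i & q i <= b]) /\
  trivIset [set: 'I_N] (fun i => `]p i, q i[%classic).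

Lemma interval_family_length (G : set R) (d a b : R) N (p q : 'I_N -> R) :
  measurable G -> (lebesgue_measure G <= d%:E)%E ->
  interval_family a b p q -> (forall i, `]p i, q i[ `<=` G) ->
  \sum_(i < N) (q i - p i) <= d.
Proof.
move=> mG Gd [pq tpq] sG.
have fam_fin : finite_set [set: 'I_N] by exact: finite_finset.
have mI (i : 'I_N) : measurable (`]p i, q i[%classic : set R) by exact: measurable_itv.
have := @measure_fin_bigcup _ _ _ lebesgue_measure _ [set: 'I_N]
   (fun i => `]p i, q i[%classic) fam_fin tpq (fun i _ => mI i).
rewrite -[X in \sum_(_ \in X) _](_ : [set` enum 'I_N] = _); last first.
  by apply/seteqP; split=> i //= _; rewrite mem_enum.
rewrite -fsbig_seq ?enum_uniq// big_enum (eq_bigl xpredT)//=.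
move=> vol; rewrite -lee_fin -sumEFin (eq_bigr (fun i => lebesgue_measure `]p i, q i[)); last first.
  move=> i _; rewrite lebesgue_measure_itv /= lte_fin -EFinB.
  by case: (pq i) => _ + _; case: ltgtP => // -> _; rewrite subrr.
rewrite -vol; apply: le_trans Gd; apply: le_measure; rewrite ?inE//.
  exact: fin_bigcup_measurable.
by move=> x [i _]; exact: sG.
Qed.

Lemma interval_family_add (a s t : R) N (p q : 'I_N -> R) (phi : R -> R) :
  interval_family a s p q -> a <= s -> s <= t ->
  exists p' q' : 'I_N.+1 -> R, [/\ interval_family a t p' q',
    (forall G : set R, (forall i, `]p i, q i[ `<=` G) -> `[s, t] `<=` G ->
       forall i, `]p' i, q' i[ `<=` G) &
    \sum_(i < N.+1) `|phi (q' i) - phi (p' i)| =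
    \sum_(i < N) `|phi (q i) - phi (p i)| + `|phi t - phi s|].
Proof.
move=> [pq tpq] as_ st.
pose ext (f : 'I_N -> R) z (i : 'I_N.+1) := oapp f z (unlift ord_max i).
have extM f z : ext f z ord_max = z by rewrite /ext unlift_none.
have extL f z i : ext f z (widen_ord (leqnSn N) i) = f i.
  rewrite /ext; have -> : widen_ord (leqnSn N) i = lift ord_max i.
    by apply: val_inj; rewrite /= /bump leqNgt ltn_ord.
  by rewrite liftK.
have indI (P : 'I_N.+1 -> Prop) : P ord_max ->
  (forall i, P (widen_ord (leqnSn N) i)) -> forall i, P i.
  move=> PM PL i; case: (unliftP ord_max i) => [j ->|-> //].
  have <- : widen_ord (leqnSn N) j = lift ord_max j; last exact: PL.
  by apply: val_inj; rewrite /= /bump leqNgt ltn_ord.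
exists (ext p s), (ext q t); split.
- split.
    apply: (indI); first by rewrite !extM.
    by move=> i; rewrite !extL; have [? ? qs] := pq i; split => //;
      exact: le_trans qs st.
  have disj i x : `]p i, q i[%classic x -> `]s, t[%classic x -> False.
    have [_ _ qs] := pq i; rewrite /= !in_itv/= => /andP[_ xq] /andP[sx _]; lra.
  apply: (indI).
    apply: (indI) => // j _ _; rewrite !extL !extM => -[x [xs xp]].
    by case: (disj j x).
  move=> i; apply: (indI).
    move=> _ _; rewrite !extL !extM => -[x [xs xp]].
    by case: (disj i x).
  by move=> j _ _; rewrite !extL => /(tpq i j Logic.I Logic.I) ->.
- move=> G pG sG; apply: (indI); last by move=> i; rewrite !extL.
  by rewrite !extM => x xst; apply: sG; exact: subset_itv_oo_cc xst.
- rewrite big_ord_recr/= !extM; congr (_ + _).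
  by apply: eq_bigr => i _; rewrite !extL.
Qed.

(** The exceptional null set is covered by an open set [G] so small that the
    variation of [phi] over finite families of intervals inside [G] is small.
    Outside [G] the local growth of [phi] is controlled by the derivative, inside
    [G] by the variation [V t] of [phi] on [G] before [t]; so [phi t] minus [V t]
    and a small slope times [t] satisfies [nonincreasing_of_local]. *)
Lemma absolutely_continuous_nonincreasing (phi : R -> R) (a b : R) : a <= b ->
  absolutely_continuous a b phi ->
  {ae mu, forall s, a < s < b -> forall e, 0 < e -> exists2 d, 0 < d &
     forall x, s < x -> x < s + d -> phi x <= phi s + e * (x - s)} ->
  phi b <= phi a.
Proof.
move=> ab ac [A [mA A0 NA]].
apply/ler_addgt0Pr => e e0.
have e2 : 0 < e / 2 by rewrite divr_gt0.
have [d d0 acd] := ac _ e2.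
(* [a] joins the null set: the hypothesis says nothing about the growth of [phi] to the right of [a]. *)
have [G [oG AG Gd]] : exists G : set R, [/\ open G, A `|` [set a] `<=` G &
    (lebesgue_measure G <= (d / 2)%:E)%E].
  have d20 : 0 < d / 2 by rewrite divr_gt0.
  have [G [oG AG Gd]] := @outer_measure_open_le R (A `|` [set a]) _ d20.
  exists G; split => //; apply: (le_trans Gd).
  rewrite -[leRHS]add0e leeD2r//.
  have -> : 0%E = (((wlength (@idfun R))^*)%mu A + ((wlength (@idfun R))^*)%mu [set a])%E.
    rewrite [X in (X + _)%E](_ : _ = 0%E); last exact: A0.
    by rewrite add0e; exact/esym/lebesgue_measure_set1.
  exact: outer_measureU2.
have mG : measurable G by exact: open_measurable.
pose fam (t : R) : set R := [set x | exists N (p q : 'I_N -> R),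
  [/\ interval_family a t p q, (forall i, `]p i, q i[ `<=` G) &
      x = \sum_(i < N) `|phi (q i) - phi (p i)|]].
have famB t x : t <= b -> fam t x -> x <= e / 2.
  move=> tb [N [p [q [[pq tpq] pG ->]]]]; apply: ltW; apply: acd => //.
    by move=> i; have [? ? qt] := pq i; split => //; exact: le_trans tb.
  have := interval_family_length mG Gd (conj pq tpq) pG.
  by move=> /le_lt_trans; apply; lra.
have fam0 t : fam t 0.
  by exists 0, (fun=> 0), (fun=> 0);
    split=> [|[]//|]; [split=> [[]//|[]//]|rewrite big_ord0].
have famS t : t <= b -> has_sup (fam t).
  by move=> tb; split; [exists 0|exists (e / 2) => x; exact: famB].
have fam_mono s t x : s <= t -> fam s x -> fam t x.
  move=> st [N [p [q [[pq tpq] pG ->]]]]; exists N, p, q; split => //; split => //.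
  by move=> i; have [? ? qt] := pq i; split => //; exact: le_trans st.
pose V t := sup (fam (Num.min t b)).
have Vmono : {homo V : s t / s <= t}.
  move=> s t st; apply: ge_sup; first by exists 0.
  move=> x xs; apply: ub_le_sup; first by case: (famS (Num.min t b));
    rewrite ?ge_min ?lexx ?orbT.
  by apply: fam_mono xs; rewrite le_min !ge_min st lexx !orbT.
have VG s t : a <= s -> s <= t -> t <= b -> `[s, t] `<=` G ->
  phi t - phi s <= V t - V s.
  move=> as_ st tb stG; rewrite /V !min_l ?(le_trans st)//.
  rewrite lerBrDl -lerBrDr; apply: ge_sup; first by exists 0.
  move=> _ [N [p [q [pq pG ->]]]]; rewrite lerBrDr.
  apply: (@le_trans _ _ (\sum_(i < N) `|phi (q i) - phi (p i)| + `|phi t - phi s|)).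
    by rewrite lerD2l ler_norm.
  apply: ub_le_sup; first by case: (famS _ tb).
  have [p' [q' [pq' pG' <-]]] := interval_family_add phi pq as_ st.
  by exists N.+1, p', q'; split => //; exact: pG'.
have Vb : V b <= e / 2.
  rewrite /V min_l//; apply: ge_sup; first by exists 0.
  by move=> x; exact: famB.
have Va : 0 <= V a.
  by apply: ub_le_sup => //; case: (famS (Num.min a b)); rewrite ?ge_min ?lexx ?orbT.
pose c := e / 2 / (b - a + 1).
have c0 : 0 < c by rewrite divr_gt0//; lra.
suff : phi b - (c * b + V b) <= phi a - (c * a + V a).
  have : c * (b - a) <= e / 2.
    by rewrite /c mulrAC ler_pdivrMr ?ler_pM2l; lra.
  by lra.
apply: (@nonincreasing_of_local (fun t => phi t - (c * t + V t))) => //.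
- move=> t /andP[at_ tb] eta eta0; have [d' d'0 acd'] := ac _ eta0.
  exists d' => // s as_ ts st.
  have := acd' 1%N (fun=> s) (fun=> t).
  rewrite !big_ord1 => /(_ _ _ _)/ltW h.
  have vst : c * s <= c * t by rewrite ler_pM2l ?ltW.
  have Vst := Vmono _ _ (ltW st).
  suff : `|phi t - phi s| <= eta by rewrite ler_norml => /andP[]; lra.
  apply: h; last lra.
    by move=> _; split => //; exact: ltW.
  by move=> i j _ _ _; rewrite !ord1.
- move=> t /andP[at_ tb].
  have [Gt|nGt] := pselect (G t).
    have /nbhs_ballP[d' /= d'0 dG] : nbhs t G by exact: open_nbhs_nbhs.
    exists d' => // s ts sd sb.
    have := VG t s at_ (ltW ts) sb; have : c * t <= c * s by rewrite ler_pM2l ?ltW.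
    suff : `[t, s] `<=` G by move=> h1 h2 /(_ h1); lra.
    move=> x /=; rewrite in_itv/= => /andP[tx xs]; apply: dG.
    by rewrite /ball/= ltr_norml; lra.
  have ta : a < t.
    by rewrite lt_neqAle at_ andbT; apply/eqP => aE; apply: nGt; apply: AG; right.
  have nAt : ~ A t by move=> At; apply: nGt; apply: AG; left.
  have [|d' d'0 dP] := contrapT (fun h => nAt (NA _ h)) _ c c0; first by rewrite ta.
  exists d' => // s ts sd sb.
  by have := dP s ts sd; have := Vmono _ _ (ltW ts); lra.
Qed.

End Growth.

Section AC.
Context {R : realType} {V W : normedModType R}.

(** One statement for two uses: Lipschitz functions ([z1] and [z2] constant),
    and the weighted norm of a difference of solutions. *)
Lemma absolutely_continuous_dominated (z1 z2 : R -> V) (phi : R -> W) (a b K : R) :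
  0 <= K -> absolutely_continuous a b z1 -> absolutely_continuous a b z2 ->
  (forall p q, a <= p -> p <= q -> q <= b ->
    `|phi q - phi p| <= `|z1 q - z1 p| + `|z2 q - z2 p| + K * (q - p)) ->
  absolutely_continuous a b phi.
Proof.
move=> K0 ac1 ac2 dom e e0.
have e3 : 0 < e / 3 by rewrite divr_gt0.
have [d1 d10 h1] := ac1 _ e3; have [d2 d20 h2] := ac2 _ e3.
have K1 : 0 < K + 1 by lra.
have d30 : 0 < e / 3 / (K + 1) by rewrite divr_gt0.
exists (Num.min (e / 3 / (K + 1)) (Num.min d1 d2)); first
  by rewrite !lt_min d10 d20 d30.
move=> N p q pq tpq; rewrite !lt_min => /and3P[s3 s1 s2].
have := h1 N p q pq tpq s1; have := h2 N p q pq tpq s2.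
have : K * \sum_(i < N) (q i - p i) <= e / 3.
  rewrite ltr_pdivlMr// in s3; apply: le_trans (ltW s3); rewrite mulrC ler_wpM2l//;
    last lra.
  by apply: sumr_ge0 => i _; rewrite subr_ge0; case: (pq i).
have : \sum_(i < N) `|phi (q i) - phi (p i)| <=
    \sum_(i < N) `|z1 (q i) - z1 (p i)| + \sum_(i < N) `|z2 (q i) - z2 (p i)| +
    K * \sum_(i < N) (q i - p i).
  rewrite mulr_sumr -!big_split/=; apply: ler_sum => i _.
  by have [? ? ?] := pq i; exact: dom.
lra.
Qed.

Lemma absolutely_continuous_bounded (z : R -> V) (T : R) :
  absolutely_continuous 0 T z ->
  exists2 M, 0 <= M & forall t, 0 <= t <= T -> `|z t| <= M.
Proof.
move=> ac; have [d d0 dP] := ac 1 ltr01.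
have inc p q : 0 <= p -> p <= q -> q <= T -> q - p < d -> `|z q - z p| < 1.
  move=> p0 pq qT qpd; have := dP 1%N (fun=> p) (fun=> q).
  rewrite !big_ord1; apply => //.
  by move=> i j _ _ _; rewrite !ord1.
have d2 : 0 < d / 2 by rewrite divr_gt0.
have bnd k t : 0 <= t <= T -> t <= k%:R * (d / 2) -> `|z t| <= `|z 0| + k%:R.
  elim: k t => [|k IH] t /andP[t0 tT].
    rewrite mul0r => t0'; have -> : t = 0 by apply/le_anti; rewrite t0 t0'.
    by rewrite addr0.
  have [/IH + _|tk tk1] := leP t (k%:R * (d / 2)).
    by rewrite t0 tT => /(_ isT) /le_trans; apply; rewrite lerD2l ler_nat.
  have kd0 : 0 <= k%:R * (d / 2) by apply: mulr_ge0; [exact: ler0n|exact: ltW].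
  have kdT : k%:R * (d / 2) <= T by apply: le_trans tT; exact: ltW.
  have := IH (k%:R * (d / 2)); rewrite kd0 kdT lexx => /(_ isT isT) h1.
  have h2 := inc _ _ kd0 (ltW tk) tT _.
  have : `|z t - z (k%:R * (d / 2))| < 1.
    by apply: h2; move: tk1; rewrite -natr1 mulrDl mul1r; lra.
  move=> h3; rewrite -[z t](subrK (z (k%:R * (d / 2)))) -natr1.
  by apply: le_trans (ler_normD _ _) _; lra.
pose k := (Num.truncn (T / (d / 2))).+1.
exists (`|z 0| + k%:R); first exact: addr_ge0.
move=> t /andP[t0 tT]; apply: bnd; first by rewrite t0.
rewrite -ler_pdivrMr//; apply: le_trans (ltW (truncnS_gt _)).
by rewrite ler_pM2r ?invr_gt0.
Qed.

Lemma is_derive_expansion (y : R -> V) (s : R) (D : V) : is_derive s (1 : R) y D ->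
  forall e, 0 < e -> exists2 d, 0 < d &
    forall x, s < x -> x < s + d -> `|y x - y s - (x - s) *: D| <= e * (x - s).
Proof.
move=> [dy yD] e e0.
have /cvgrPdist_le/(_ e e0) : h^-1 *: (y (h *: (1 : R) + s) - y s) @[h --> 0^'] --> D.
  by rewrite -yD; exact: dy.
rewrite near_withinE => /nbhs_ballP[d /= d0 dP]; exists d => // x sx xsd.
have xs : 0 < x - s by rewrite subr_gt0.
have := dP (x - s); rewrite /ball/= sub0r normrN gtr0_norm// => /(_ _ _).
rewrite gt_eqF// [_ *: 1]mulr1 subrK => h.
have {h} : `|D - (x - s)^-1 *: (y x - y s)| <= e by apply: h => //; lra.
rewrite -(ler_pM2r xs); apply: le_trans; rewrite mulrC -[X in X * _]gtr0_norm// -normrZ.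
by rewrite scalerBr scalerA divff ?gt_eqF// scale1r distrC.
Qed.

End AC.

Section ACLip.
Context {R : realType} {V : normedModType R}.

Definition locally_lipschitz (y : R -> V) : Prop := forall T : R, exists2 K, 0 <= K &
  forall p q, 0 <= p -> p <= q -> q <= T -> `|y q - y p| <= K * (q - p).

Lemma lipschitz_absolutely_continuous (y : R -> V) (T : R) : locally_lipschitz y ->
  absolutely_continuous 0 T y.
Proof.
move=> /(_ T)[K K0 yK].
have ac0 : absolutely_continuous 0 T (fun=> 0 : V).
  move=> e e0; exists 1 => // N p q _ _ _; rewrite big1// => i _.
  by rewrite subrr normr0.
apply: (absolutely_continuous_dominated K0 ac0 ac0) => p q p0 pq qT.
by rewrite subrr normr0 !add0r; exact: yK.
Qed.

Lemma is_derive_translate (y : R -> V) (s t : R) (D : V) :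
  is_derive (t - s) (1 : R) y D -> is_derive t (1 : R) (fun r => y (r - s)) D.
Proof.
move=> [dy yD].
have E : (fun h : R => h^-1 *: (y (h *: (1 : R) + t - s) - y (t - s))) =
  (fun h : R => h^-1 *: (y (h *: (1 : R) + (t - s)) - y (t - s))).
  by apply/funext => h; rewrite addrA.
by split; rewrite /derivable /derive /= E.
Qed.

End ACLip.

(** * Almost everywhere differentiation of integrals *)

Section RowNorm.
Context {R : realType} {n : nat}.
Implicit Types x : 'rV[R]_n.

Lemma row_norm_le x (r : R) : 0 <= r -> (forall j, `|x 0 j| <= r) -> `|x| <= r.
Proof.
move=> r0 xr; rewrite [`|x|]mx_normrE; apply/bigmax_leP; split => // -[i j] _ /=.
by rewrite ord1.
Qed.

Lemma row_coord_le x j : `|x 0 j| <= `|x|.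
Proof.
by rewrite [`|x|]mx_normrE; apply: (le_bigmax _ (fun ij => `|x ij.1 ij.2|) (0, j)).
Qed.

End RowNorm.

Section Differentiation.
Context {R : realType}.
Local Notation mu := (@completed_lebesgue_measure R).
Local Notation line := (lebesgue_line R).

Lemma ae_completed (P : R -> Prop) :
  {ae @lebesgue_measure R, forall s, P s} -> {ae mu, forall s, P s}.
Proof.
move=> [A [mA A0 PA]]; exists A; split => //.
exact: measurable_line_borel.
Qed.

Lemma ae_line_mono (P Q : R -> Prop) : (forall s, P s -> Q s) ->
  {ae mu, forall s : R, P s} -> {ae mu, forall s : R, Q s}.
Proof. by move=> PQ; apply: negligibleS => s nQ /PQ. Qed.

Lemma ae_line_mono2 (P Q S : R -> Prop) : (forall s, P s -> Q s -> S s) ->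
  {ae mu, forall s : R, P s} -> {ae mu, forall s : R, Q s} ->
  {ae mu, forall s : R, S s}.
Proof.
move=> PQS nP nQ; apply: negligibleS (negligibleU nP nQ) => s /= nS.
by apply: contrapT => /not_orP[/contrapT Ps /contrapT Qs]; apply: nS; exact: PQS.
Qed.

(** Lebesgue's differentiation theorem for a Borel version of [h] cut at an integer
    [k], for all [k]; near a time below [k] the integral of the cut Borel version is
    that of [h]. *)
Lemma is_derive_integral (h : line -> R) : measurable_fun [set: line] h ->
  (forall T : R, exists B : R, forall s : R, 0 <= s <= T -> `|h s| <= B) ->
  {ae mu, forall s : R, 0 < s ->
    is_derive s (1 : R) (fun t => \int[mu]_(r in `[0, t]) h r) (h s)}.
Proof.
move=> mh hB.
have [M [mM M0 mg]] := borel_version mh.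
have mitv (i : interval R) : @measurable _ (measurableTypeR R) [set` i].
  by have := measurable_itv i.
pose g : measurableTypeR R -> R := h \_ (~` M).
have gE s : ~ M s -> g s = h s by move=> Ms; rewrite /g patchE ifT// inE.
have gB (T B : R) : (forall s : R, 0 <= s <= T -> `|h s| <= B) ->
  forall s : R, 0 <= s <= T -> `|g s| <= B.
  move=> hTB s sT; rewrite /g patchE; case: ifP => _; first exact: hTB.
  by rewrite normr0; apply: le_trans (hTB _ sT).
have gline : measurable_fun [set: line] g.
  exact: (measurableT_comp mg measurable_line_id).
have ig (k : R) : lebesgue_measure.-integrable `[0, k] (EFin \o g).
  have [B Bk] := hB k; apply: measurable_bounded_integrable => //.
  - change (@lebesgue_measure R `[0%R, k]%classic < +oo)%E.
    by rewrite lebesgue_measure_itv /=; case: ifP => _; rewrite ltry.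
  - exact: measurable_funTS.
  - exists B; split; first exact: num_real.
    move=> C BC s /=; rewrite in_itv/= => s0k.
    by apply: le_trans (ltW BC); exact: gB s0k.
have Fk (k : nat) : {ae mu, forall s : R, 0 < s < k%:R ->
    is_derive s (1 : R) (fun t => \int[mu]_(r in `[0, t]) h r) (g s)}.
  suff : {ae @lebesgue_measure R, forall s : R, 0 < s < k%:R ->
      is_derive s (1 : R) (fun t => \int[mu]_(r in `[0, t]) h r) (g s)}.
    exact: (@ae_completed (fun s : R => 0 < s < k%:R ->
      is_derive s (1 : R) (fun t => \int[mu]_(r in `[0, t]) h r) (g s))).
  pose gk : R -> R := g \_ `[0, k%:R].
  have igk : lebesgue_measure.-integrable [set: R] (EFin \o gk).
    have := ig k%:R; rewrite integrable_mkcond; last exact: mitv.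
    by rewrite restrict_EFin.
  have locg : locally_integrable [set: R] gk.
    by apply: integrable_locally => //; exact: mitv.
  have intg y : lebesgue_measure.-integrable `[0, y] (EFin \o gk).
    by apply: integrableS igk => //; exact: mitv.
  have [A [mA A0 PA]] := @FTC1 R gk (BLeft 0) intg locg.
  exists A; split => // s /= ns; apply: PA => /= ftc; apply: ns => /andP[s0 sk].
  have [|dF FE] := ftc; first by rewrite lte_fin.
  have gks : gk s = g s.
    by rewrite /gk patchE ifT// inE /= in_itv/= !ltW.
  rewrite -gks -FE.
  move/derivableP : dF => dF.
  rewrite derive1E; apply: near_eq_is_derive dF.
  have : \forall x \near (s : R), x < k%:R by exact: lt_nbhsl.
  apply: filterS => t tk.
  have mit : @measurable _ line `[0, t] := @measurable_line_itv R _.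
  transitivity (\int[lebesgue_measure]_(r in `[0, t]) g r).
    apply: eq_Rintegral => r; rewrite inE /= in_itv/= => /andP[r0 rt].
    by rewrite /gk patchE ifT// inE /= in_itv/= r0 (le_trans rt)// ltW.
  congr fine.
  have [B Bt] := hB t.
  rewrite -(@integral_completed R `[0, t]%classic (EFin \o g)); last 3 first.
  - exact: mitv.
  - exact/measurable_EFinP.
  - apply: (@integrable_line_itv _ _ _ _ B); first exact: measurable_funTS.
    exact: gB.
  apply: ae_eq_integral.
  - exact: mit.
  - by apply/measurable_EFinP; exact: measurable_funTS.
  - by apply/measurable_EFinP; exact: measurable_funTS.
  - exists M; split => //; first exact: measurable_line_borel.
    by move=> r /= nr; apply: contrapT => Mr; apply: nr => _; rewrite /= gE.
have := ae_foralln Fk.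
have nM : mu.-negligible M by exists M; split => //; exact: measurable_line_borel.
move=> FkA; have := negligibleU FkA nM; apply: negligibleS => s /=.
move=> ns; apply: contrapT => /not_orP[/contrapT FkS Ms]; apply: ns => s0.
rewrite -gE//; apply: (FkS (Num.truncn s).+1); rewrite s0/=.
exact: truncnS_gt.
Qed.

End Differentiation.

Section VectorIntegral.
Context {R : realType} {n : nat}.
Local Notation mu := (@completed_lebesgue_measure R).
Local Notation line := (lebesgue_line R).
Implicit Types (w : line -> 'rV[R]_n).

Lemma Rintegral_line_point (h : line -> R) (a : R) : \int[mu]_(s in `[a, a]) h s = 0.
Proof.
rewrite (@eq_Rintegral _ _ _ _ _ (fun=> h a)); last first.
  by move=> s; rewrite inE/= in_itv/= => /le_anti ->.
by rewrite Rintegral_line_cst// subrr mulr0.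
Qed.

Lemma Rintegral_line_expR (k t : R) : 0 < k -> 0 <= t ->
  \int[mu]_(s in `[0, t]) expR (k * s) = (expR (k * t) - 1) / k.
Proof.
move=> k0 t0.
have dE (s : R) : is_derive s (1 : R) (fun s => expR (k * s)) (k * expR (k * s)).
  by rewrite -[k]opprK; exact: is_derive_exp_scaled.
have cE : continuous (fun s : R => expR (k * s)).
  by move=> s; apply: differentiable_continuous; exact/derivable1_diffP/ex_derive.
move: t0; rewrite le_eqVlt => /predU1P[<-|t0].
  by rewrite mulr0 expR0 subrr mul0r Rintegral_line_point.
rewrite /Rintegral ge0_integral_completed; last 3 first.
- by have := measurable_itv `[0, t].
- apply/measurable_EFinP; apply: measurable_funTS.
  exact: measurable_expR_scaled.
- by move=> s; rewrite lee_fin expR_ge0.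
pose F (s : R) := k^-1 * expR (k * s).
have dF (s : R) : is_derive s (1 : R) F (expR (k * s)).
  by apply: is_derive_eq; rewrite /GRing.scale/= mulrA mulVf ?mul1r ?gt_eqF.
have cF : continuous F.
  by move=> s; apply: differentiable_continuous; exact/derivable1_diffP/ex_derive.
rewrite (@continuous_FTC2 _ _ F 0 t)//=.
- by rewrite /F mulr0 expR0 mulr1 mulrC mulrBl mul1r.
- exact/continuous_subspaceT.
- split=> [s _||]; first exact: ex_derive.
    by apply: cvg_at_right_filter; exact: cF.
  by apply: cvg_at_left_filter; exact: cF.
- by move=> s _; rewrite derive1E; exact: derive_val.
Qed.

Definition regular_field w : Prop :=
  (forall j, measurable_fun (`[0, +oo[ : set line) (fun s => w s 0 j)) /\
  (forall T : R, exists B : R, forall s : R, 0 <= s <= T -> `|w s| <= B).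

Definition vector_integral w (t : R) : 'rV[R]_n :=
  \row_j \int[mu]_(s in `[0, t]) w s 0 j.

Lemma regular_field_measurable w (a b : R) j : regular_field w -> 0 <= a ->
  measurable_fun (`[a, b]%classic : set line) (fun s => w s 0 j).
Proof.
move=> [mw _] a0; apply: measurable_funS (mw j); first exact: measurable_line_itv.
by move=> s /=; rewrite !in_itv/= andbT => /andP[/(le_trans a0)].
Qed.

Lemma regular_field_integrable w (a b : R) j : regular_field w -> 0 <= a ->
  mu.-integrable `[a, b] (EFin \o (fun s => w s 0 j)).
Proof.
move=> rw a0; have [B wB] := rw.2 b.
apply: (@integrable_line_itv _ _ _ _ B); first exact: regular_field_measurable.
move=> s /andP[as_ sb]; apply: le_trans (row_coord_le _ _) _; apply: wB.
by rewrite sb (le_trans a0).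
Qed.

Lemma vector_integral_le0 w t : t <= 0 -> vector_integral w t = 0.
Proof.
move=> t0; apply/rowP => j; rewrite !mxE.
move: t0; rewrite le_eqVlt => /predU1P[->|t0].
  exact: Rintegral_line_point.
by rewrite set_itv_ge ?bnd_simp -?ltNge// Rintegral_set0.
Qed.

Lemma vector_integral_increment w (a b B : R) : regular_field w -> 0 <= a -> a <= b ->
  (forall s, a <= s <= b -> `|w s| <= B) ->
  `|vector_integral w b - vector_integral w a| <= B * (b - a).
Proof.
move=> rw a0 ab wB.
have B0 : 0 <= B by apply: le_trans (normr_ge0 (w a)) _; apply: wB; rewrite lexx.
apply: row_norm_le => [|j]; first by rewrite mulr_ge0// subr_ge0.
have split := Rintegral_line_split a0 ab (regular_field_integrable b j rw (lexx 0)).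
rewrite 3!mxE [vector_integral w a 0 j]mxE split [X in `|X|]addrAC subrr add0r.
have mw := regular_field_measurable (b := b) j rw a0.
have wb s : a <= s <= b -> - B <= w s 0 j <= B.
  by move=> /wB wsB; rewrite -ler_norml; exact: le_trans (row_coord_le _ _) wsB.
by rewrite ler_norml -mulNr; exact: (Rintegral_line_bounds ab mw wb).
Qed.

Lemma vector_integral_lipschitz w (T : R) : regular_field w ->
  exists2 B, 0 <= B & forall s t, s <= t -> t <= T ->
    `|vector_integral w t - vector_integral w s| <= B * (t - s).
Proof.
move=> rw; have [B wB] := rw.2 T; exists (Num.max 0 B); first by rewrite le_max lexx.
move=> s t st tT.
have B0 : 0 <= Num.max 0 B by rewrite le_max lexx.
have [t0|t0] := leP t 0.
  by rewrite !vector_integral_le0 ?(le_trans st)// subrr normr0 mulr_ge0 ?subr_ge0.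
have wM r : 0 <= r <= t -> `|w r| <= Num.max 0 B.
  move=> /andP[r0 rt]; rewrite le_max wB ?orbT// r0; exact: le_trans tT.
have [s0|s0] := leP s 0.
  rewrite (vector_integral_le0 _ s0) -(vector_integral_le0 w (lexx 0)).
  apply: le_trans (vector_integral_increment rw (lexx 0) (ltW t0) wM) _.
  by rewrite ler_wpM2l// lerD2l lerN2.
apply: (vector_integral_increment rw) => // [|r /andP[sr rt]]; first exact: ltW.
by apply: wM; rewrite rt (le_trans (ltW s0)).
Qed.

Lemma vector_integral_continuous w : regular_field w -> continuous (vector_integral w).
Proof.
move=> rw t.
have [B B0 lip] := @vector_integral_lipschitz w (t + 1) rw.
apply/cvgrPdist_le => e e0.
pose d := Num.min 1 (e / (B + 1)).
have B1 : 0 < B + 1 by lra.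
have d0 : 0 < d by rewrite lt_min ltr01 divr_gt0.
apply/nbhs_ballP; exists d => // s; rewrite /ball/= lt_min => /andP[ts1 tse].
have le_e : B * `|t - s| <= e.
  rewrite ltr_pdivlMr// in tse; apply: le_trans (ltW tse); rewrite mulrC ler_wpM2l//;
    lra.
apply: le_trans le_e; have [st|ts] := leP s t.
  by rewrite ger0_norm ?subr_ge0//; apply: lip => //; lra.
rewrite distrC [X in _ * X]distrC gtr0_norm ?subr_gt0//; apply: lip; first exact: ltW.
by move: ts1; rewrite ltr_norml; lra.
Qed.

(** The exponential weight makes Picard iteration a contraction on the whole
    half-line: with [k] twice the Lipschitz constant, integrating the difference of
    the fields halves the bound. *)
Lemma vector_integral_compare w w' (c k t : R) : regular_field w -> regular_field w' ->
  0 < k -> 0 <= c -> 0 <= t ->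
  (forall s, 0 <= s <= t -> `|w s - w' s| <= c * expR (k * s)) ->
  `|vector_integral w t - vector_integral w' t| <= c / k * expR (k * t).
Proof.
move=> rw rw' k0 c0 t0 ww'.
have mi : @measurable _ line `[0, t] := @measurable_line_itv R _.
have iE : mu.-integrable `[0, t] (EFin \o (fun s : R => expR (k * s))).
  apply: (@integrable_line_itv _ _ _ _ (expR (k * t))).
    by apply: measurable_funTS; exact: measurable_line_expR.
  move=> s /andP[s0 st]; rewrite ger0_norm ?expR_ge0// ler_expR.
  by rewrite ler_pM2l.
apply: row_norm_le => [|j]; first by rewrite mulr_ge0 ?expR_ge0// divr_ge0// ltW.
have iw := regular_field_integrable t j rw (lexx 0).
have iw' := regular_field_integrable t j rw' (lexx 0).
rewrite !mxE -RintegralB//.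
apply: (@le_trans _ _ (\int[mu]_(s in `[0, t]) (c * expR (k * s)))).
  apply: le_trans (le_normr_Rintegral mi (integrableB mi iw iw')) _.
  apply: le_Rintegral => //.
  - exact: integrable_norm (integrableB mi iw iw').
  - exact: (integrableZl mi c iE).
  - move=> s /=; rewrite in_itv/= => /ww'; apply: le_trans.
    by have := row_coord_le (w s - w' s) j; rewrite !mxE.
rewrite RintegralZl// Rintegral_line_expR// -mulrA ler_wpM2l//.
by rewrite mulrC ler_pM2l ?invr_gt0// gerBl.
Qed.

Lemma is_derive_vector_integral w : regular_field w ->
  {ae mu, forall s : R, 0 < s -> is_derive s (1 : R) (vector_integral w) (w s)}.
Proof.
move=> rw.
have coordD j : {ae mu, forall s : R, 0 < s ->
   is_derive s (1 : R) (fun t => vector_integral w t 0 j) (w s 0 j)}.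
  pose h : line -> R := (fun s => w s 0 j) \_ `[0, +oo[.
  have hE s : 0 <= s -> h s = w s 0 j.
    by move=> s0; rewrite /h patchE ifT// inE /= in_itv/= s0.
  have mh : measurable_fun [set: line] h.
    have m0 : @measurable _ line `[0, +oo[ := @measurable_line_itv R _.
    exact: (iffLR (measurable_restrictT _ m0) (rw.1 j)).
  have hB (T : R) : exists B : R, forall s : R, 0 <= s <= T -> `|h s| <= B.
    have [B wB] := rw.2 T; exists B => s sT; rewrite hE; last by case/andP: sT.
    exact: le_trans (row_coord_le _ _) (wB _ sT).
  apply: ae_line_mono (is_derive_integral mh hB) => s + s0 => /(_ s0).
  rewrite hE; last exact: ltW.
  apply: near_eq_is_derive; near=> t; rewrite mxE; apply: eq_Rintegral => r.
  by rewrite inE/= in_itv/= => /andP[r0 _]; rewrite hE.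
have : {ae mu, forall s : R, forall j, 0 < s ->
   is_derive s (1 : R) (fun t => vector_integral w t 0 j) (w s 0 j)}.
  pose P (k : nat) (s : line) := forall j : 'I_n, nat_of_ord j = k -> 0 < (s : R) ->
    is_derive (s : R) (1 : R) (fun t => vector_integral w t 0 j) (w s 0 j).
  have aeP k : {ae mu, forall s, P k s}.
    have [kn|nk] := ltnP k n.
      apply: ae_line_mono (coordD (Ordinal kn)) => s ws j jk.
      by have -> : j = Ordinal kn by exact: val_inj.
    by apply: aeW => s j jk; move: nk; rewrite -jk leqNgt ltn_ord.
  by apply: ae_line_mono (ae_foralln aeP) => s Ps j; exact: Ps.
apply: ae_line_mono => s ws s0.
have ds : derivable (vector_integral w) s 1.
  by apply/derivable_mxP => i j; rewrite ord1;
    exact: (@ex_derive _ _ _ _ _ _ _ (ws j s0)).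
split => //; rewrite derive_mx//; apply/rowP => j; rewrite mxE.
exact: (@derive_val _ _ _ _ _ _ _ (ws j s0)).
Unshelve. all: by end_near. Qed.

End VectorIntegral.

(** * Measurability along a trajectory *)

Section Controls.
Context {R : realType} {n : nat} {U : metricType R}.
Local Notation mu := (@completed_lebesgue_measure R).
Local Notation line := (lebesgue_line R).
Implicit Types (u : R -> U) (y : R -> 'rV[R]_n).

(** An open [W] is the union of the products [B * C], where [B] runs over the balls
    of rational centres and radii and [C] is the interior of the set of the
    controls [v] with [B * {v}] inside [W]. The union is countable whatever [U]. *)
Lemma measurable_line_state_control u y (A : set ('rV[R]_n * U)) :
  controls u -> continuous y -> borel_set A ->
  @measurable _ line (`[0, +oo[ `&` (fun s => (y s, u s)) @^-1` A).
Proof.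
move=> mu_ cy; move: A.
have m0 : @measurable _ line `[0, +oo[ := @measurable_line_itv R _.
apply: smallest_sub.
  split=> [|A mA|F mF].
  - by rewrite preimage_set0 setI0; exact: measurable0.
  - rewrite (_ : _ `&` _ = `[0, +oo[ `\` (`[0, +oo[ `&` (fun s => (y s, u s)) @^-1` A)).
      exact: measurableD.
    apply/seteqP; split => s /= [s0]; first by case=> _ nA; split => // -[].
    by move=> nA; split => //; split => // As; apply: nA.
  - by rewrite preimage_bigcup setI_bigcupr; exact: bigcupT_measurable.
move=> W oW /=.
pose center (qk : 'rV[rat]_n * nat) : 'rV[R]_n := map_mx ratr qk.1.
pose B qk := ball (center qk) qk.2.+1%:R^-1.
pose C (qk : 'rV[rat]_n * nat) := [set v : U | forall a, B qk a -> W (a, v)]°.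
pose P (qk : 'rV[rat]_n * nat) :
  set line := (`[0, +oo[ `&` y @^-1` B qk) `&` (`[0, +oo[ `&` u @^-1` C qk).
have -> : `[0, +oo[ `&` (fun s => (y s, u s)) @^-1` W =
    \bigcup_(m : nat) oapp P set0 (unpickle m).
  apply/seteqP; split => s /=; last first.
    move=> [m _]; case: (unpickle m) => [qk|] //= -[[s0 Bs] [_ Cs]]; split => //.
    by have := interior_subset Cs; exact.
  move=> [s0 Ws].
  have [[N O] /= [Ny Ou] NOW] : nbhs (y s, u s) W by exact: open_nbhs_nbhs.
  move/nbhs_ballP : Ny => [r /= r0 rN].
  pose k := Num.truncn (2 / r).
  have k0 : 0 < k.+1%:R^-1 :> R by rewrite invr_gt0.
  have kr : k.+1%:R^-1 + k.+1%:R^-1 <= r.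
    have : 2 / r <= k.+1%:R by exact/ltW/truncnS_gt.
    rewrite ler_pdivrMr// => h; rewrite -div1r -mulrDl ler_pdivrMr//.
    by rewrite mulrC.
  have qP j : exists q : rat, ball (y s 0 j) k.+1%:R^-1 (ratr q : R).
    have [|q] := @rat_in_itvoo R (y s 0 j) (y s 0 j + k.+1%:R^-1).
      by rewrite ltrDl.
    rewrite in_itv/= => /andP[qy yq]; exists q.
    rewrite /ball/= distrC ltr_norml ltrBlDl yq andbT.
    by rewrite (@lt_trans _ _ 0) ?oppr_lt0 ?subr_gt0.
  pose q : 'rV[rat]_n := \row_j projT1 (cid (qP j)).
  have yq : ball (y s) k.+1%:R^-1 (center (q, k)).
    split => // i j; rewrite ord1 !mxE /=; exact: projT2 (cid (qP j)).
  exists (pickle (q, k)) => //=; rewrite pickleK/=; split; split => //.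
    exact: ball_sym.
  apply: (filterS _ Ou) => v Ov a Ba; apply: NOW; split => //=.
  apply: rN; apply: (le_ball kr); exact: ball_triangle yq Ba.
apply: bigcupT_measurable => m; case: (unpickle m) => [qk|]; last exact: measurable0.
apply: measurableI.
  apply: measurableI => //; apply: measurable_line_borel; apply: open_measurable.
  by apply: open_comp => [s _|]; [exact: cy|exact: ball_open].
apply: mu_; apply: sub_sigma_algebra; exact: open_interior.
Qed.

Lemma measurable_fun_state_control u y (h : 'rV[R]_n * U -> R) :
  controls u -> continuous y -> borel_measurable h ->
  measurable_fun (`[0, +oo[ : set line) (fun s => h (y s, u s)).
Proof.
move=> mu_ cy mh; apply: (measurability _ (RGenOInfty.measurableE R)).
move=> _ [_ [c ->] <-].
have bA : borel_set (h @^-1` `]c, +oo[).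
  by apply: mh; apply: sub_sigma_algebra; exact: interval_open.
exact: measurable_line_state_control mu_ cy bA.
Qed.

Lemma continuous_borel_measurable (T T' : topologicalType) (h : T -> T') :
  continuous h -> borel_measurable h.
Proof.
move=> ch; rewrite /borel_measurable /borel_set; apply: smallest_sub.
  split=> [|A mA|F mF].
  - by rewrite preimage_set0; exact: sigma_algebra0.
  - exact: sigma_algebraCD.
  - by rewrite preimage_bigcup; exact: sigma_algebra_bigcup.
move=> W oW; apply: sub_sigma_algebra; apply: open_comp => // x _; exact: ch.
Qed.

Definition concat_control (s : R) (u v : R -> U) : R -> U :=
  fun r => if r < s then u r else v (r - s).

Lemma controls_concat s u v : 0 <= s -> controls u -> controls v ->
  controls (concat_control s u v).
Proof.
move=> s0 mu_ mv A bA.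
have -> : `[0, +oo[ `&` concat_control s u v @^-1` A =
   (`[0, s[ `&` (`[0, +oo[ `&` u @^-1` A)) `|`
   (fun r : R => r + - s) @^-1` (`[0, +oo[ `&` v @^-1` A).
  apply/seteqP; split => r /=; rewrite /concat_control !in_itv/= !andbT.
    by move=> []; case: ltP => rs r0 Ar; [left|right]; rewrite ?r0 ?subr_ge0.
  case=> [[/andP[_ rs] [r0]]|[rs]]; first by rewrite rs.
  by rewrite subr_ge0 in rs; rewrite ltNge rs/=; split => //; exact: le_trans rs.
apply: measurableU.
  by apply: measurableI; [exact: measurable_line_itv|exact: mu_].
by apply: measurable_translate; exact: mv.
Qed.

Lemma controls_cst (v : U) : controls (fun=> v).
Proof.
move=> A bA; rewrite (_ : (fun=> v) @^-1` A = if v \in A then setT else set0).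
  case: ifP => _; rewrite ?setIT ?setI0; [exact: measurable_line_itv|exact: measurable0].
apply/seteqP; split=> s /=; case: ifPn => //; first by rewrite notin_setE.
by move=> /set_mem.
Qed.

End Controls.

(** * Existence, uniqueness and concatenation of trajectories *)

Section Picard.
Context {R : realType} {n : nat} {U : metricType R}.
Variables (f : 'rV[R]_n -> U -> 'rV[R]_n).
Local Notation mu := (@completed_lebesgue_measure R).
Local Notation line := (lebesgue_line R).
Implicit Types (u : R -> U) (y : R -> 'rV[R]_n).
Hypothesis f_lip : state_lipschitz f.
Hypothesis f_cont : forall y : 'rV[R]_n, continuous (f y).
Hypothesis f_growth : linear_growth f.

Lemma field_continuous : continuous (fun z : 'rV[R]_n * U => f z.1 z.2).
Proof.
have [L L0 fL] := f_lip; move=> [a v] /=.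
apply/cvgrPdist_lt => e e0.
have L1 : 0 < L + 1 by lra.
exists ([set a' | `|a - a'| < e / 2 / (L + 1)], [set v' | `|f a v - f a v'| < e / 2]).
  split=> /=.
    have d0 : 0 < e / 2 / (L + 1) by rewrite !divr_gt0.
    apply/nbhs_ballP; exists (e / 2 / (L + 1)) => // a'.
    by rewrite -ball_normE.
  by have /cvgrPdist_lt := @f_cont a v; apply; lra.
move=> z [/= h1 h2].
have -> : f a v - f z.1 z.2 = (f a v - f a z.2) + (f a z.2 - f z.1 z.2).
  by rewrite addrA subrK.
apply: le_lt_trans (ler_normD _ _) _.
have := fL a z.1 z.2.
rewrite ltr_pdivlMr// in h1.
have := normr_ge0 (a - z.1); nra.
Qed.

Lemma continuous_bounded y (T : R) : continuous y ->
  exists B : R, forall s : R, 0 <= s <= T -> `|y s| <= B.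
Proof.
move=> cy; have [T0|T0] := leP 0 T; last first.
  by exists 0 => s /andP[s0 /(le_trans s0)]; rewrite leNgt T0.
have [|c _ cP] := @EVT_max R (fun s => `|y s|) 0 T T0.
  by apply: continuous_subspaceT => s; apply: cvg_norm; exact: cy.
by exists `|y c| => s sT; apply: cP; rewrite in_itv.
Qed.

Lemma regular_field_of_control u y : controls u -> continuous y ->
  regular_field (fun s => f (y s) (u s)).
Proof.
move=> mu_ cy; split.
  move=> j; apply: (@measurable_fun_state_control R n U u y (fun z => f z.1 z.2 0 j)) => //.
  apply: continuous_borel_measurable => z.
  exact: (@continuous_comp _ _ _ (fun z => f z.1 z.2) (fun x : 'rV[R]_n => x 0 j) z
     (field_continuous (x := z)) (coord_continuous (x := _))).
move=> T; have [C C0 fC] := f_growth; have [B yB] := continuous_bounded T cy.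
exists (C * (1 + B)) => s /yB ysB.
by apply: le_trans (fC _ _) _; rewrite ler_wpM2l// lerD2l.
Qed.

Fixpoint picard (y0 : 'rV[R]_n) u (k : nat) : R -> 'rV[R]_n :=
  if k is k'.+1 then fun t => y0 + vector_integral (fun s => f (picard y0 u k' s) (u s)) t
  else fun=> y0.

Lemma picard_continuous (y0 : 'rV[R]_n) u k : controls u -> continuous (picard y0 u k).
Proof.
move=> mu_; elim: k => [|k IH] /=; first by move=> t; exact: cvg_cst.
move=> t; apply: cvgD; first exact: cvg_cst.
apply: vector_integral_continuous; exact: regular_field_of_control.
Qed.

(** The lower bounds [a k - 2 K / 2 ^ k] increase, the upper bounds
    [a k + 2 K / 2 ^ k] decrease, and the supremum of the former separates them. *)
Lemma geometric_limit (a : nat -> R) (K : R) :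
  (forall k, `|a k.+1 - a k| <= K / 2 ^+ k) ->
  exists l, forall k, `|a k - l| <= 2 * K / 2 ^+ k.
Proof.
move=> aK.
pose lo k := a k - 2 * K / 2 ^+ k; pose up k := a k + 2 * K / 2 ^+ k.
have p2 k : 0 < 2 ^+ k :> R by rewrite exprn_gt0.
have half k : 2 * K / 2 ^+ k.+1 = K / 2 ^+ k.
  by rewrite exprS invfM mulrA mulrAC mulrC !mulrA mulVf ?mul1r// mulrC.
have dbl k : 2 * K / 2 ^+ k = K / 2 ^+ k + K / 2 ^+ k
  by rewrite -mulrA mulr2n mulrDl !mul1r.
have lo_mono : {homo lo : i j / (i <= j)%N >-> i <= j}.
  apply: homo_leq => [//|? ? ?|k]; first exact: le_trans.
  by have := aK k; rewrite /lo half dbl ler_norml; lra.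
have up_mono : {homo up : i j / (i <= j)%N >-> j <= i}.
  apply: homo_leq => [//|? ? ? h1 h2|k]; first exact: le_trans h2 h1.
  by have := aK k; rewrite /up half dbl ler_norml; lra.
have K0 : 0 <= K by have := aK 0%N; rewrite expr0 divr1; apply: le_trans.
have lo_up i j : lo i <= up j.
  apply: (@le_trans _ _ (lo (maxn i j))); first by apply: lo_mono; exact: leq_maxl.
  apply: (@le_trans _ _ (up (maxn i j))); last by apply: up_mono; exact: leq_maxr.
  rewrite /lo /up lerD2l; set x := _ / _; suff : 0 <= x by lra.
  by apply: divr_ge0; [exact: mulr_ge0|exact: ltW].
have supl : has_sup (range lo).
  by split; [exists (lo 0%N), 0%N|exists (up 0%N) => _ [k _ <-]].
exists (sup (range lo)) => k.
have h1 : lo k <= sup (range lo) by apply: ub_le_sup; [case: supl|exists k].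
have h2 : sup (range lo) <= up k by apply: ge_sup; [case: supl|move=> _ [i _ <-]].
by rewrite ler_norml; move: h1 h2; rewrite /lo /up; lra.
Qed.

Lemma exists_div_exp2_lt (M e : R) : 0 < e -> exists k, M / 2 ^+ k < e.
Proof.
move=> e0; exists (Num.truncn (M / e)).+1.
rewrite ltr_pdivrMr ?exprn_gt0// mulrC -ltr_pdivrMr//.
apply: lt_trans (truncnS_gt _) _; rewrite -natrX ltr_nat.
exact: ltn_expl.
Qed.

(** The differences of the iterates satisfy
    |Y (k + 1) t - Y k t| <= K 2^(-k) exp(2 L t), so the iterates converge locally
    uniformly, and one may pass to the limit in the integral equation. *)
Lemma integral_equation_solvable (y0 : 'rV[R]_n) u : controls u ->
  exists2 y, continuous y &
    forall t, y t = y0 + vector_integral (fun s => f (y s) (u s)) t.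
Proof.
move=> mu_; have [L' L'0 fL'] := f_lip; have [C C0 fC] := f_growth.
(* the weights of the iteration require a positive constant *)
pose L := L' + 1.
have L0 : 0 < L by rewrite /L; lra.
have fL a b v : `|f a v - f b v| <= L * `|a - b|.
  by apply: le_trans (fL' _ _ _) _; rewrite ler_wpM2r// /L lerDl.
pose Y := picard y0 u.
pose w k s := f (Y k s) (u s).
have rw k : regular_field (w k) by apply: regular_field_of_control => //;
  exact: picard_continuous.
pose K := C * (1 + `|y0|) / (2 * L).
have L2 : 0 < 2 * L by rewrite mulr_gt0.
have K0 : 0 <= K.
  by apply: divr_ge0; [apply: mulr_ge0 => //; apply: addr_ge0|exact: ltW].
have step k (t : R) : 0 <= t -> `|Y k.+1 t - Y k t| <= K / 2 ^+ k * expR (2 * L * t).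
  elim: k t => [|k IH] t t0.
    rewrite /Y /= addrC addKr expr0 divr1.
    have := vector_integral_increment (rw 0%N) (lexx 0) t0 (fun s _ => fC y0 (u s)).
    rewrite (vector_integral_le0 _ (lexx 0)) !subr0 => /le_trans; apply.
    rewrite /K [leRHS]mulrAC ler_pdivlMr// -[leLHS]mulrA.
    apply: ler_wpM2l; first by apply: mulr_ge0 => //; apply: addr_ge0.
    by have := expR_ge1Dx (2 * L * t); rewrite mulrC; lra.
  rewrite /Y /= opprD addrACA subrr add0r.
  have c0 : 0 <= L * (K / 2 ^+ k).
    by apply: mulr_ge0; [exact: ltW|apply: divr_ge0 => //; exact: exprn_ge0].
  apply: le_trans (vector_integral_compare (rw k.+1) (rw k) L2 c0 t0 _) _.
  - move=> s /andP[s0 _]; apply: le_trans (fL _ _ _) _.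
    by rewrite -mulrA ler_pM2l//; exact: IH.
  - rewrite le_eqVlt; apply/orP; left; apply/eqP; congr (_ * _).
    by rewrite exprS; field; rewrite expf_neq0//= gt_eqF.
pose E (t : R) : R := expR (2 * L * Num.max 0 t).
have Y0 k (t : R) : t <= 0 -> Y k t = y0.
  by move=> t0; case: k => [|k] //; rewrite /Y /= vector_integral_le0// addr0.
have stepE k t : `|Y k.+1 t - Y k t| <= K * E t / 2 ^+ k.
  rewrite /E; have [t0|t0] := leP t 0; last by rewrite mulrAC; apply: step; exact: ltW.
  rewrite !Y0// subrr normr0.
  by apply: divr_ge0; [apply: mulr_ge0 => //; exact: expR_ge0|exact: exprn_ge0].
have lim t : exists x, forall k, `|Y k t - x| <= 2 * (K * E t) / 2 ^+ k.
  have limj j : exists l, forall k, `|Y k t 0 j - l| <= 2 * (K * E t) / 2 ^+ k.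
    apply: geometric_limit => k; apply: le_trans (stepE k t).
    by have := row_coord_le (Y k.+1 t - Y k t) j; rewrite !mxE.
  exists (\row_j projT1 (cid (limj j))) => k; apply: row_norm_le => [|j].
    apply: divr_ge0; last exact: exprn_ge0.
    by apply: mulr_ge0 => //; apply: mulr_ge0 => //; exact: expR_ge0.
  rewrite !mxE; exact: projT2 (cid (limj j)) k.
have [y yY] := choice lim.
have Emono (s t : R) : s <= t -> E s <= E t.
  by move=> st; rewrite /E ler_expR ler_pM2l// ge_max !le_max lexx/= st orbT.
have cy : continuous y.
  move=> t; apply/cvgrPdist_le => e e0.
  have e3 : 0 < e / 3 by rewrite divr_gt0.
  have [k ke] := exists_div_exp2_lt (2 * (K * E (t + 1))) e3.
  have := @picard_continuous y0 u k mu_ t.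
  move=> /cvgrPdist_le /(_ (e / 3) e3).
  move=> /nbhs_ballP[d /= d0 dP].
  apply/nbhs_ballP; exists (Num.min 1 d) => [|s] /=; first by rewrite lt_min ltr01.
  rewrite /ball/= lt_min => /andP[ts1 tsd].
  have near_y (r : R) : r <= t + 1 -> `|Y k r - y r| <= e / 3.
    move=> rt; apply: le_trans (yY r k) _; apply: le_trans (ltW ke).
    by rewrite ler_pM2r ?invr_gt0 ?exprn_gt0// ler_pM2l// ler_wpM2l// Emono.
  have h1 := near_y t _; have h2 := near_y s _; have h3 := dP s tsd.
  have -> : y t - y s = - (Y k t - y t) + (Y k t - Y k s) + (Y k s - y s).
    by rewrite opprB !addrA !subrK.
  apply: le_trans (ler_normD _ _) _; apply: le_trans (lerD (ler_normD _ _) (lexx _)) _.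
  rewrite normrN; move: h1 h2 h3; rewrite /Y /=.
  have -> : t <= t + 1 by lra.
  have -> : s <= t + 1 by move: ts1; rewrite ltr_norml; lra.
  move=> /(_ isT) ? /(_ isT) ? ?; lra.
exists y => // t.
have rwy := regular_field_of_control mu_ cy.
have main k : `|y t - (y0 + vector_integral (fun s => f (y s) (u s)) t)| <= 2 * (K * E t) / 2 ^+ k.
  have [t0|t0] := leP t 0.
    by rewrite vector_integral_le0// addr0 -(Y0 k t t0) distrC; exact: yY.
  have Et : E t = expR (2 * L * t) by rewrite /E max_r// ltW.
  have d1 := yY t k.+1.
  have d2 : `|vector_integral (w k) t - vector_integral (fun s => f (y s) (u s)) t|
     <= L * (2 * K / 2 ^+ k) / (2 * L) * expR (2 * L * t).
    apply: vector_integral_compare => //; last 2 first.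
    - exact: ltW.
    - move=> s /andP[s0 st]; apply: le_trans (fL _ _ _) _.
      rewrite -mulrA ler_pM2l//; apply: le_trans (yY s k) _.
      by rewrite /E max_r// mulrA -mulrA [X in _ * X <= _]mulrC mulrA.
    - apply: mulr_ge0; first exact: ltW.
      by apply: divr_ge0; [exact: mulr_ge0|exact: exprn_ge0].
  have -> : y t - (y0 + vector_integral (fun s => f (y s) (u s)) t) =
     - (Y k.+1 t - y t) + (vector_integral (w k) t - vector_integral (fun s => f (y s) (u s)) t).
    rewrite /Y /= opprB -!addrA; congr (_ + _).
    by rewrite !opprD -!addrA; congr (_ + _); rewrite addrA addNr add0r.
  apply: le_trans (ler_normD _ _) _; rewrite normrN.
  apply: le_trans (lerD d1 d2) _; rewrite Et le_eqVlt; apply/orP; left; apply/eqP.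
  by rewrite exprS; field; rewrite expf_neq0//= gt_eqF.
apply/eqP; rewrite -subr_eq0 -normr_le0; apply/ler_addgt0Pl => e e0.
have [k ke] := exists_div_exp2_lt (2 * (K * E t)) e0.
by rewrite addr0; apply: le_trans (main k) (ltW ke).
Qed.

End Picard.

Lemma expR_decay_lipschitz (R : realType) (L p q : R) : 0 <= L -> 0 <= p -> p <= q ->
  0 <= expR (- L * p) - expR (- L * q) <= L * (q - p).
Proof.
move=> L0 p0 pq.
have -> : expR (- L * q) = expR (- L * p) * expR (- L * (q - p)).
  by rewrite -expRD; congr expR; ring.
have e1 : expR (- L * p) <= 1 by rewrite -expR0 ler_expR mulNr oppr_le0 mulr_ge0.
have e0 := expR_gt0 (- L * p).
have h1 : 1 - L * (q - p) <= expR (- L * (q - p)).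
  by apply: le_trans (expR_ge1Dx _); lra.
have h2 : expR (- L * (q - p)) <= 1.
  by rewrite -expR0 ler_expR mulNr oppr_le0 mulr_ge0// subr_ge0.
have h3 : 0 <= L * (q - p) by rewrite mulr_ge0// subr_ge0.
have h4 : 0 <= 1 - expR (- L * (q - p)) by lra.
rewrite -[X in X - _]mulr1 -mulrBr; apply/andP; split; first by rewrite mulr_ge0// ltW.
by apply: (@le_trans _ _ (1 - expR (- L * (q - p)))); [exact: ler_piMl|lra].
Qed.

Section Trajectories.
Context {R : realType} {n : nat} {U : metricType R}.
Variables (f : 'rV[R]_n -> U -> 'rV[R]_n).
Implicit Types (u : R -> U) (y : R -> 'rV[R]_n).
Hypothesis f_lip : state_lipschitz f.

(** The function exp(- L t) |y1 t - y2 t| vanishes at 0 and is nonincreasing, since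
    the norm of the difference grows at a rate at most [L] times itself at almost
    every time. *)
Lemma solution_unique (y0 : 'rV[R]_n) u y1 y2 : is_solution f u y0 y1 ->
  is_solution f u y0 y2 ->
  forall t, 0 <= t -> y1 t = y2 t.
Proof.
move=> [y10 ac1 d1] [y20 ac2 d2] t; rewrite le_eqVlt => /predU1P[<-|t0]; first
  by rewrite y10.
have [L L0 fL] := f_lip.
pose phi s := expR (- L * s) * `|y1 s - y2 s|.
have [M1 M10 bM1] := absolutely_continuous_bounded (ac1 t t0).
have [M2 M20 bM2] := absolutely_continuous_bounded (ac2 t t0).
have acphi : absolutely_continuous 0 t phi.
  apply: (@absolutely_continuous_dominated _ _ _ y1 y2 phi 0 t ((M1 + M2) * L)); [|exact: ac1|exact: ac2|].
    by rewrite mulr_ge0// addr_ge0.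
  move=> p q p0 pq qt.
  have /andP[E1 E2] := expR_decay_lipschitz L0 p0 pq.
  have E3 : expR (- L * q) <= 1.
    by rewrite -expR0 ler_expR mulNr oppr_le0 mulr_ge0// (le_trans p0).
  have E4 := expR_ge0 (- L * q).
  have Z : `|y1 p - y2 p| <= M1 + M2.
    by apply: le_trans (ler_normB _ _) _; apply: lerD; [apply: bM1|apply: bM2];
      rewrite p0 (le_trans pq).
  have D : `| `|y1 q - y2 q| - `|y1 p - y2 p| | <= `|y1 q - y1 p| + `|y2 q - y2 p|.
    apply: le_trans (ler_dist_dist _ _) _.
    have -> : y1 q - y2 q - (y1 p - y2 p) = (y1 q - y1 p) - (y2 q - y2 p).
      by rewrite !opprB addrACA [- y2 q + _]addrC [X in _ = _ + X]addrC addrACA [X in _ = _ + X]addrC.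
    exact: ler_normB.
  have -> : phi q - phi p = expR (- L * q) * (`|y1 q - y2 q| - `|y1 p - y2 p|)
     - (expR (- L * p) - expR (- L * q)) * `|y1 p - y2 p|.
    by rewrite /phi; ring.
  apply: le_trans (ler_normB _ _) _; apply: lerD; rewrite normrM.
    rewrite ger0_norm//; apply: le_trans D; exact: ler_piMl.
  rewrite ger0_norm// normr_id -mulrA mulrC; apply: ler_pM => //.
have : phi t <= phi 0.
  apply: (absolutely_continuous_nonincreasing (ltW t0) acphi).
  apply: (ae_line_mono2 _ d1 d2) => s h1 h2 /andP[s0 st] e e0.
  have e2 : 0 < e / 2 by rewrite divr_gt0.
  have [r1 r10 x1] := is_derive_expansion (h1 s0) e2.
  have [r2 r20 x2] := is_derive_expansion (h2 s0) e2.
  exists (Num.min r1 r2) => [|x sx]; first by rewrite lt_min r10.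
  rewrite -ltrBlDl lt_min !ltrBlDl => /andP[xr1 xr2].
  have z1 := x1 x sx xr1; have z2 := x2 x sx xr2.
  have xs : 0 < x - s by rewrite subr_gt0.
  have Z : `|y1 x - y2 x| <= `|y1 s - y2 s| * (1 + L * (x - s)) + e * (x - s).
    set D1 := f (y1 s) (u s) in z1 *; set D2 := f (y2 s) (u s) in z2 *.
    have -> : y1 x - y2 x = (y1 x - y1 s - (x - s) *: D1) - (y2 x - y2 s - (x - s) *: D2)
        + ((y1 s - y2 s) + (x - s) *: (D1 - D2)).
      by rewrite scalerBr; apply/rowP => j; rewrite !mxE; ring.
    apply: le_trans (ler_normD _ _) _.
    have w1 := ler_normB (y1 x - y1 s - (x - s) *: D1) (y2 x - y2 s - (x - s) *: D2).
    have w2 := ler_normD (y1 s - y2 s) ((x - s) *: (D1 - D2)).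
    have w3 : `|(x - s) *: (D1 - D2)| <= (x - s) * (L * `|y1 s - y2 s|).
      by rewrite normrZ gtr0_norm// ler_pM2l//; exact: fL.
    lra.
  have E1 : expR (- L * x) = expR (- L * s) * expR (- L * (x - s)).
    by rewrite -expRD; congr expR; ring.
  have E2 : expR (- L * (x - s)) * (1 + L * (x - s)) <= 1.
    have := expR_ge1Dx (L * (x - s));
      rewrite -(ler_pM2l (expR_gt0 (- L * (x - s)))) => /le_trans; apply.
    by rewrite -expRD mulNr addNr expR0.
  have E3 : expR (- L * x) <= 1.
    by rewrite -expR0 ler_expR mulNr oppr_le0 mulr_ge0//; lra.
  have n0 := normr_ge0 (y1 s - y2 s).
  rewrite /phi; apply: le_trans (ler_wpM2l (expR_ge0 _) Z) _.
  rewrite mulrDr; apply: lerD; last by rewrite ler_piMl// mulr_ge0// ltW.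
  rewrite E1 -mulrA ler_pM2l ?expR_gt0// mulrCA.
  exact: ler_piMr.
rewrite /phi y10 y20 subrr normr0 mulr0 pmulr_rle0 ?expR_gt0// normr_le0 subr_eq0.
by move/eqP.
Qed.

End Trajectories.

Section Trajectory.
Context {R : realType} {n : nat} {U : metricType R}.
Variables (f : 'rV[R]_n -> U -> 'rV[R]_n).
Local Notation mu := (@completed_lebesgue_measure R).
Local Notation line := (lebesgue_line R).
Implicit Types (u : R -> U).
Hypothesis f_lip : state_lipschitz f.
Hypothesis f_cont : forall y : 'rV[R]_n, continuous (f y).
Hypothesis f_growth : linear_growth f.

(** The default value in the definition of [trajectory] is never used, and the
    trajectory has the regularity of the solution of the integral equation. *)
Lemma trajectoryP u (y0 : 'rV[R]_n) : controls u ->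
  [/\ is_solution f u y0 (trajectory f u y0),
      locally_lipschitz (trajectory f u y0) &
      exists2 y : R -> 'rV[R]_n, continuous y & forall t, 0 <= t ->
        trajectory f u y0 t = y t].
Proof.
move=> mu_.
have [y cy yE] := integral_equation_solvable f_lip f_cont f_growth y0 mu_.
have rw := regular_field_of_control f_lip f_cont f_growth mu_ cy.
have lip : locally_lipschitz y.
  move=> T; have [K K0 KP] := vector_integral_lipschitz T rw;
    exists K => // p q p0 pq qT.
  by rewrite (yE q) (yE p) opprD addrACA subrr add0r; exact: KP.
have ysol : is_solution f u y0 y.
  split.
  - by rewrite yE vector_integral_le0// addr0.
  - by move=> T T0; exact: lipschitz_absolutely_continuous.
  - apply: ae_line_mono (is_derive_vector_integral rw) => s + s0 => /(_ s0) ds.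
    have yE' : y = (fun=> y0) + vector_integral (fun s => f (y s) (u s))
      by exact/funext.
    rewrite [X in is_derive _ _ X _]yE'.
    by have := is_deriveD (is_derive_cst y0 s (1 : R)) ds; rewrite add0r.
have tsol : is_solution f u y0 (trajectory f u y0).
  by apply: (@xgetPex _ (fun=> y0) [set y | is_solution f u y0 y]); exists y.
have ty t : 0 <= t -> trajectory f u y0 t = y t.
  exact: (solution_unique f_lip tsol ysol).
split => //; last by exists y.
move=> T; have [K K0 KP] := lip T; exists K => // p q p0 pq qT.
by rewrite !ty ?(le_trans p0)//; exact: KP.
Qed.

(** The concatenated function is locally Lipschitz, and almost every time is
    different from [s] and is not a translate of an exceptional time of the second
    trajectory; so it is a solution, hence the only one. *)
Lemma trajectory_concat u v (y0 : 'rV[R]_n) (s : R) : controls u -> controls v ->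
  0 <= s ->
  let w := concat_control s u v in
  (forall t, 0 <= t -> t <= s -> trajectory f w y0 t = trajectory f u y0 t) /\
  (forall r, 0 <= r -> trajectory f w y0 (s + r) = trajectory f v (trajectory f u y0 s) r).
Proof.
move=> mu_ mv s0 w.
pose y1 := trajectory f u y0; pose y2 := trajectory f v (y1 s).
have [[y10 _ d1] lip1 _] := trajectoryP y0 mu_.
have [[y20 _ d2] lip2 _] := trajectoryP (y1 s) mv.
rewrite -/y1 in y10 d1 lip1; rewrite -/y2 in y20 d2 lip2.
pose y3 t := if t <= s then y1 t else y2 (t - s).
have y3l t : t <= s -> y3 t = y1 t by move=> ts; rewrite /y3 ts.
have y3r t : s <= t -> y3 t = y2 (t - s).
  rewrite le_eqVlt => /predU1P[<-|st]; first by rewrite y3l// subrr y20.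
  by rewrite /y3 leNgt st.
have lip3 : locally_lipschitz y3.
  move=> T; have [K1 K10 P1] := lip1 T; have [K2 K20 P2] := lip2 T.
  exists (K1 + K2); first exact: addr_ge0.
  move=> p q p0 pq qT.
  have [qs|sq] := leP q s.
    rewrite !y3l ?(le_trans pq)//; apply: le_trans (P1 _ _ p0 pq qT) _.
    by rewrite ler_wpM2r ?subr_ge0// lerDl.
  have [ps|sp] := leP p s; last first.
    rewrite (y3r q (ltW sq)) (y3r p (ltW sp)).
    have h : `|y2 (q - s) - y2 (p - s)| <= K2 * (q - s - (p - s)) by apply: P2; lra.
    have h4 : 0 <= K1 * (q - p) by rewrite mulr_ge0// subr_ge0.
    apply: le_trans h _; lra.
  rewrite (y3r q (ltW sq)) (y3l p ps) -[y2 _](subrK (y2 0)) {2}y20 -addrA.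
  apply: le_trans (ler_normD _ _) _.
  have h1 := P1 p s p0 ps (le_trans (ltW sq) qT).
  have h2 : `|y2 (q - s) - y2 0| <= K2 * (q - s - 0) by apply: P2; lra.
  have h3 : 0 <= K2 * (s - p) by rewrite mulr_ge0// subr_ge0.
  have h4 : 0 <= K1 * (q - s) by rewrite mulr_ge0// subr_ge0 ltW.
  lra.
have sol3 : is_solution f w y0 y3.
  split.
  - by rewrite y3l.
  - by move=> T _; exact: lipschitz_absolutely_continuous.
  - have d2s : {ae mu, forall t : R, 0 < t - s ->
      is_derive (t - s) (1 : R) y2 (f (y2 (t - s)) (v (t - s)))}.
      exact: negligible_translate d2.
    have ds : {ae mu, forall t : R, t != s}.
      exists [set s]; split; last by move=> t /= /negP; rewrite negbK => /eqP.
        by rewrite -[X in measurable X]set_itv1; exact: measurable_line_itv.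
      exact: lebesgue_line_set1.
    have d12 : {ae mu, forall t : R, t != s /\ (0 < t ->
      is_derive t (1 : R) y1 (f (y1 t) (u t)))}.
      by apply: (ae_line_mono2 _ ds d1).
    apply: (ae_line_mono2 _ d12 d2s) => t [ts h1] h2 t0.
    have [tls|slt|tE] := ltgtP t s; last by rewrite tE eqxx in ts.
    + rewrite (y3l t (ltW tls)) /w /concat_control tls.
      apply: near_eq_is_derive (h1 t0); near=> r; rewrite y3l//.
      by near: r; apply: filterS (lt_nbhsl tls) => r; exact: ltW.
    + rewrite (y3r t (ltW slt)) /w /concat_control ltNge (ltW slt)/=.
      apply: near_eq_is_derive (is_derive_translate (h2 _)); last by rewrite subr_gt0.
      near=> r; rewrite y3r//.
      by near: r; apply: filterS (lt_nbhsr slt) => r; exact: ltW.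
have mw : controls w by exact: controls_concat.
have [wsol _ _] := trajectoryP y0 mw.
have E := solution_unique f_lip wsol sol3.
split=> [t t0 ts|r r0]; first by rewrite E// y3l.
by rewrite E ?addr_ge0// y3r ?lerDl// addrAC subrr add0r.
Unshelve. all: by end_near. Qed.

End Trajectory.

(** * Cumulated and discounted costs *)

Section Discount.
Context {R : realType}.
Local Notation mu := (@completed_lebesgue_measure R).
Local Notation line := (lebesgue_line R).
Implicit Types (h : line -> R) (l s t : R).

Definition cost_rate h : Prop :=
  measurable_fun (`[0, +oo[%classic : set line) h /\ forall s : R, 0 <= s ->
    0 <= h s <= 1.

Definition cumulated h t : R := \int[mu]_(s in `[0, t]) h s.

Definition discounted l h : R := l * \int[mu]_(s in `[0, +oo[) (expR (- l * s) * h s).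

Lemma cost_rate_shift h s : 0 <= s -> cost_rate h -> cost_rate (fun r : R => h (s + r)).
Proof.
move=> s0 [mh h01]; split; last by move=> r r0; apply: h01; exact: addr_ge0.
have ms : measurable_fun (`[0, +oo[%classic : set line) (fun r : R => (r + s : line)).
  by move=> m0 A mA; apply: measurableI => //; exact: measurable_translate.
rewrite (_ : (fun r : R => h (s + r)) = h \o (fun r : R => r + s)); last first.
  by apply/funext => r /=; rewrite addrC.
apply: (measurable_comp _ _ mh ms); first exact: measurable_line_itv.
by move=> _ [r /= + <-]; rewrite !in_itv/= !andbT => r0; exact: addr_ge0.
Qed.

Lemma cost_rate_onem h : cost_rate h -> cost_rate (fun s => 1 - h s).
Proof.
move=> [mh h01]; split; first by apply: measurable_funB => //; exact: measurable_cst.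
by move=> s /h01; lra.
Qed.

Lemma cost_rate_measurable h (i : interval R) : cost_rate h ->
  [set` i] `<=` `[0, +oo[%classic ->
  measurable_fun ([set` i] : set line) h.
Proof. by move=> [mh _] i0; apply: measurable_funS mh => //;
  exact: measurable_line_itv. Qed.

Lemma cost_rate_integrable h a b : cost_rate h -> 0 <= a ->
  mu.-integrable `[a, b] (EFin \o h).
Proof.
move=> rh a0; apply: (@integrable_line_itv _ _ _ _ 1).
  apply: cost_rate_measurable => // s /=; rewrite !in_itv/= => /andP[as_ _].
  by rewrite (le_trans a0).
by move=> s /andP[as_ _]; have /andP[h0 h1] := rh.2 s (le_trans a0 as_);
  rewrite ger0_norm.
Qed.

Lemma cumulated0 h : cumulated h 0 = 0.
Proof. exact: Rintegral_line_point. Qed.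

Lemma cumulated_increment h s t : cost_rate h -> 0 <= s -> s <= t ->
  0 <= cumulated h t - cumulated h s <= t - s.
Proof.
move=> rh s0 st; rewrite /cumulated (Rintegral_line_split s0 st (cost_rate_integrable t rh (lexx 0))).
rewrite addrAC subrr add0r.
have := @Rintegral_line_bounds _ h s t 0 1 st.
rewrite mul0r mul1r; apply.
  apply: cost_rate_measurable => // r /=; rewrite !in_itv/= => /andP[sr _].
  by rewrite (le_trans s0).
by move=> r /andP[sr _]; apply: rh.2; exact: le_trans sr.
Qed.

Lemma cumulated_shift h s t : cost_rate h -> 0 <= s -> 0 <= t ->
  cumulated (fun r : R => h (s + r)) t = cumulated h (s + t) - cumulated h s.
Proof.
move=> rh s0 t0; have sst : s <= s + t by rewrite lerDl.
rewrite /cumulated (Rintegral_line_split s0 sst (cost_rate_integrable _ rh (lexx 0))).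
rewrite [RHS]addrAC subrr add0r -[RHS](@ge0_Rintegral_translate _ s).
- rewrite (_ : _ @^-1` _ = `[0, t]%classic); last first.
    by apply/seteqP; split => r /=; rewrite !in_itv/= [s + t]addrC lerD2r lerDr.
  by apply: eq_Rintegral => r _; rewrite addrC.
- exact: measurable_line_itv.
- apply: cost_rate_measurable => // r /=; rewrite !in_itv/= => /andP[sr _].
  by rewrite (le_trans s0).
- move=> r /=; rewrite in_itv/= => /andP[sr _].
  by have /andP[] := rh.2 r (le_trans s0 sr).
Qed.

Lemma discounted_rate l h : 0 < l -> cost_rate h ->
  cost_rate (fun s : R => expR (- l * s) * h s).
Proof.
move=> l0 [mh h01]; split.
  have mL : measurable_fun (`[0, +oo[%classic : set line) (fun s : R => expR (- l * s)).
    by apply: measurable_funTS; exact: measurable_line_expR.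
  exact: measurable_funM mL mh.
move=> s s0; have /andP[h0 h1] := h01 s s0; have e0 := expR_ge0 (- l * s).
have e1 : expR (- l * s) <= 1 by rewrite -expR0 ler_expR mulNr oppr_le0 mulr_ge0// ltW.
by rewrite mulr_ge0//= mulr_ile1.
Qed.

Lemma discounted_integrable l h (a : R) : 0 < l -> cost_rate h -> 0 <= a ->
  mu.-integrable `[a, +oo[ (EFin \o (fun s : R => expR (- l * s) * h s)).
Proof.
move=> l0 rh a0; have [ie _] := integrable_line_expR a l0.
have mi : @measurable _ line `[a, +oo[ := @measurable_line_itv R _.
apply: (le_integrable mi _ _ ie) => [|s].
  apply/measurable_EFinP; apply: cost_rate_measurable; first exact: discounted_rate.
  by move=> s /=; rewrite !in_itv/= !andbT; exact: le_trans.
rewrite /= in_itv/= andbT => as_; rewrite lee_fin.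
have /andP[h0 h1] := rh.2 s (le_trans a0 as_).
by rewrite normrM (ger0_norm h0) ler_piMr.
Qed.

Lemma cumulated_discount_increment l h s t : 0 < l -> cost_rate h -> 0 <= s -> s <= t ->
  cumulated (fun s : R => expR (- l * s) * h s) t - cumulated (fun s : R => expR (- l * s) * h s) s
    <= expR (- l * s) * (cumulated h t - cumulated h s).
Proof.
move=> l0 rh s0 st; have rd := discounted_rate l0 rh.
rewrite /cumulated (Rintegral_line_split s0 st (cost_rate_integrable t rh (lexx 0))).
rewrite (Rintegral_line_split s0 st (cost_rate_integrable t rd (lexx 0))).
rewrite [leLHS]addrAC subrr add0r [X in _ * X]addrAC subrr add0r.
have mi : @measurable _ line `[s, t] := @measurable_line_itv R _.
have ih := cost_rate_integrable t rh s0.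
rewrite -RintegralZl//; apply: le_Rintegral => //.
- exact: cost_rate_integrable.
- exact: (integrableZl mi (expR (- l * s)) ih).
- move=> r /=; rewrite in_itv/= => /andP[sr rt].
  have /andP[h0 h1] := rh.2 r (le_trans s0 sr).
  by rewrite ler_wpM2r// ler_expR !mulNr lerN2 ler_pM2l.
Qed.

Lemma cumulated_discount_ge l h t : 0 < l -> cost_rate h -> 0 <= t ->
  expR (- l * t) * cumulated h t <= cumulated (fun s : R => expR (- l * s) * h s) t.
Proof.
move=> l0 rh t0; have rd := discounted_rate l0 rh.
have mi : @measurable _ line `[0, t] := @measurable_line_itv R _.
have ih := cost_rate_integrable t rh (lexx 0).
rewrite /cumulated -RintegralZl//; apply: le_Rintegral => //.
- exact: (integrableZl mi (expR (- l * t)) ih).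
- exact: cost_rate_integrable.
- move=> r /=; rewrite in_itv/= => /andP[sr rt].
  have /andP[h0 h1] := rh.2 r sr.
  by rewrite ler_wpM2r// ler_expR !mulNr lerN2 ler_pM2l.
Qed.

Lemma discounted_split l h t : 0 < l -> cost_rate h -> 0 <= t ->
  discounted l h = l * cumulated (fun s : R => expR (- l * s) * h s) t +
    expR (- l * t) * discounted l (fun r : R => h (t + r)).
Proof.
move=> l0 rh t0; have rd := discounted_rate l0 rh.
rewrite /discounted [RHS]addrC mulrCA [RHS]addrC -mulrDr; congr (_ * _).
have mi (i : interval R) : @measurable _ line [set` i] := @measurable_line_itv R i.
have i0 := discounted_integrable l0 rh (lexx 0).
have it := discounted_integrable l0 rh t0.
have rs := cost_rate_shift t0 rh.
have setE : (`[0, +oo[%classic : set line) = `[0, t[%classic `|` `[t, +oo[%classic.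
  by rewrite -itv_bndbnd_setU// bnd_simp.
rewrite [LHS](_ : _ = \int[mu]_(s in `[0, t[%classic `|` `[t, +oo[%classic)
  (expR (- l * s) * h s)); last by rewrite -setE.
rewrite Rintegral_setU//; last 2 first.
- by rewrite -itv_bndbnd_setU// bnd_simp.
- by apply/disj_setPS => s [/=]; rewrite !in_itv/= andbT => /andP[_ st];
    rewrite leNgt st.
congr (_ + _).
  rewrite /cumulated; congr fine;
    rewrite [RHS](@negligible_integral _ _ _ mu _ [set t])//.
  - congr (integral mu _ _); apply/seteqP; split => s /=; rewrite !in_itv/=.
      by move=> /andP[-> st]; split; [rewrite ltW|apply/eqP; rewrite lt_eqF].
    by move=> [/andP[-> st] sE]; rewrite lt_neqAle st andbT; apply/eqP.
  - by rewrite -[X in measurable X]set_itv1; exact: mi.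
  - exact: cost_rate_integrable.
  - exact: lebesgue_line_set1.
have /= <- := RintegralZl (expR (- l * t)) (mi _) (discounted_integrable l0 rs (lexx 0)).
rewrite -(@ge0_Rintegral_translate _ t).
- rewrite (_ : _ @^-1` _ = `[0, +oo[%classic); last first.
    by apply/seteqP; split => r /=; rewrite !in_itv/= !andbT lerDr.
  apply: eq_Rintegral => r _; rewrite mulrA -expRD [r + t]addrC; congr (expR _ * _);
    ring.
- exact: mi.
- apply: cost_rate_measurable => // s /=; rewrite !in_itv/= !andbT; exact: le_trans.
- move=> s /=; rewrite in_itv/= andbT => ts.
  by have /andP[] := rd.2 s (le_trans t0 ts).
Qed.

Lemma discounted_onem l h : 0 < l -> cost_rate h ->
  discounted l (fun s => 1 - h s) = 1 - discounted l h.
Proof.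
move=> l0 rh; have [ie ieE] := integrable_line_expR 0 l0.
have mi : @measurable _ line `[0, +oo[ := @measurable_line_itv R _.
rewrite /discounted; under eq_Rintegral do rewrite mulrBr mulr1.
rewrite RintegralB//; last exact: discounted_integrable.
by rewrite ieE mulr0 expR0 mulrBr mulrCA divff ?gt_eqF// mulr1.
Qed.

Lemma discounted_ge0 l h : 0 < l -> cost_rate h -> 0 <= discounted l h.
Proof.
move=> l0 rh; apply: mulr_ge0; first exact: ltW.
apply: Rintegral_ge0 => s /=; rewrite in_itv/= andbT => s0.
by have /andP[] := (discounted_rate l0 rh).2 s s0.
Qed.

Lemma discounted_le1 l h : 0 < l -> cost_rate h -> discounted l h <= 1.
Proof.
move=> l0 rh; have := discounted_ge0 l0 (cost_rate_onem rh).
by rewrite discounted_onem// subr_ge0.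
Qed.

Lemma cumulated_onem h t : cost_rate h -> 0 <= t ->
  cumulated (fun s => 1 - h s) t = t - cumulated h t.
Proof.
move=> rh t0; have mi : @measurable _ line `[0, t] := @measurable_line_itv R _.
have ic : mu.-integrable `[0, t] (EFin \o (fun=> 1)).
  apply: (@integrable_line_itv _ _ _ _ 1); first exact: measurable_cst.
  by move=> s _; rewrite normr1.
rewrite /cumulated RintegralB//; last exact: cost_rate_integrable.
by rewrite Rintegral_line_cst// mul1r subr0.
Qed.

End Discount.

(** * Discounted costs under a quadratic bound *)

Section Comparison.
Context {R : realType}.
Implicit Types (h : R -> R) (l s t : R).

Lemma expR_neg_tail (e : R) : 0 < e -> exists2 x : R, 0 < x & expR (- x) * (1 + x) <= e.
Proof.
move=> e0; exists (4 / e); first by rewrite divr_gt0.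
set x := 4 / e; have x0 : 0 < x by rewrite divr_gt0.
have ex : e * x = 4 by rewrite /x mulrC divfK ?gt_eqF.
have h1 : 1 + x / 2 <= expR (x / 2) by exact: expR_ge1Dx.
have h2 : expR x = expR (x / 2) * expR (x / 2) by rewrite -expRD; congr expR; field.
have E0 := expR_gt0 (- x).
have h3 : (1 + x) <= e * expR x.
  have : (1 + x / 2) * (1 + x / 2) <= expR (x / 2) * expR (x / 2)
    by apply: ler_pM => //; lra.
  rewrite -h2 -(ler_pM2l e0) => /(le_trans _); apply.
  have -> : e * ((1 + x / 2) * (1 + x / 2)) = e + e * x + e * x * x / 4 by field.
  by rewrite ex; lra.
apply: le_trans (ler_wpM2l (ltW E0) h3) _.
by rewrite mulrCA -expRD addNr expR0 mulr1.
Qed.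

(** With [G] the cumulated cost and [P] the discounted cost before [s], divided by
    [l], integration by parts says that [P - exp(- l s) G] has derivative
    [l exp(- l s) G], at most that of [- exp(- l s) A], where [A] is the quadratic
    polynomial with [l A - A'] equal to [l] times the given bound. The comparison is
    carried out on increments, since [h] need not be continuous; the extra
    slope [eps] absorbs the second order terms. *)
Lemma discounted_le_poly l h (a b c : R) : 0 < l -> cost_rate h ->
  0 <= a -> 0 <= b -> 0 <= c ->
  (forall s : R, 0 <= s -> cumulated h s <= a + b * s + c * s ^+ 2) ->
  discounted l h <= a * l + b + 2 * c / l.
Proof.
move=> l0 rh a0 b0 c0 Gle.
pose G s := cumulated h s.
pose P s := cumulated (fun s : R => expR (- l * s) * h s) s.
(* the coefficients that make [A - A' / l] equal to the given bound, see [AP] *)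
pose b' := b + 2 * c / l; pose a' := a + b' / l.
have b'0 : 0 <= b' by rewrite addr_ge0// divr_ge0 ?(ltW l0)// mulr_ge0.
have a'0 : 0 <= a' by rewrite addr_ge0// divr_ge0 ?(ltW l0).
pose A s := a' + b' * s + c * s ^+ 2.
have A0 s : 0 <= s -> 0 <= A s.
  move=> s0; apply: addr_ge0; last by apply: mulr_ge0 => //; exact: sqr_ge0.
  by apply: addr_ge0 => //; exact: mulr_ge0.
have AP s : A s = a + b * s + c * s ^+ 2 + (b' + 2 * c * s) / l.
  by rewrite /A /a' /b'; field; rewrite gt_eqF.
have Ginc s t : 0 <= s -> s <= t -> 0 <= G t - G s <= t - s.
  by move=> s0 st; exact: cumulated_increment.
have G0 : G 0 = 0 by exact: cumulated0.
have Gle_id s : 0 <= s -> 0 <= G s <= s.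
  by move=> s0; have := Ginc 0 s (lexx 0) s0; rewrite G0 !subr0.
have Pinc s t : 0 <= s -> s <= t -> P t - P s <= expR (- l * s) * (G t - G s).
  by move=> s0 st; exact: cumulated_discount_increment.
pose psi eps s := P s - expR (- l * s) * G s + expR (- l * s) * A s - eps * s.
have fin T : 0 <= T -> P T <= expR (- l * T) * T + a'.
  move=> T0; apply/ler_addgt0Pr => e e0.
  pose eps := e / (T + 1).
  have T1 : 0 < T + 1 by lra.
  have eps0 : 0 < eps by rewrite divr_gt0.
  have epsT : eps * T <= e.
    by rewrite /eps mulrAC ler_pdivrMr// ler_pM2l//; lra.
  have main : psi eps T <= psi eps 0.
    apply: nonincreasing_of_local => //.
    - move=> t /andP[t0 tT] eta eta0.
      pose K := l * T + (b' + 2 * c * T).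
      have K0 : 0 <= K.
        by rewrite addr_ge0// ?mulr_ge0 ?(ltW l0)// addr_ge0// mulr_ge0// mulr_ge0.
      have K1 : 0 < K + 1 by lra.
      exists (eta / (K + 1)) => [|s s0 ts st]; first by rewrite divr_gt0.
      have hd : (K + 1) * (t - s) <= eta.
        by rewrite mulrC -ler_pdivlMr//; lra.
      have /andP[d1 d2] := expR_decay_lipschitz (ltW l0) s0 (ltW st).
      have h1 := Pinc s t s0 (ltW st).
      have /andP[g0 g1] := Gle_id t (ltW t0).
      have h2 : (expR (- l * s) - expR (- l * t)) * G t <= l * (t - s) * T.
        by apply: ler_pM => //; exact: le_trans tT.
      have e1 : expR (- l * s) <= 1
        by rewrite -expR0 ler_expR mulNr oppr_le0 mulr_ge0// ltW.
      have As : A t - A s <= (t - s) * (b' + 2 * c * T).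
        have -> : A t - A s = (t - s) * (b' + c * (t + s)) by rewrite /A; ring.
        rewrite ler_pM2l ?subr_gt0// lerD2l [2 * c]mulrC -mulrA ler_wpM2l//; lra.
      have As0 : 0 <= A t - A s.
        have -> : A t - A s = (t - s) * (b' + c * (t + s)) by rewrite /A; ring.
        by rewrite mulr_ge0 ?subr_ge0 ?(ltW st)// addr_ge0// mulr_ge0// addr_ge0// ltW.
      have h3 : expR (- l * s) * (A t - A s) <= (t - s) * (b' + 2 * c * T).
        by apply: le_trans As; exact: ler_piMl.
      have h4 : 0 <= (expR (- l * s) - expR (- l * t)) * A t.
        by rewrite mulr_ge0// A0// ltW.
      have h5 : 0 <= eps * (t - s) by rewrite mulr_ge0 ?ltW// subr_gt0.
      move: hd; rewrite /K /psi; lra.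
    - move=> t /andP[t0 tT].
      pose K := l * (b' + 2 * c * T).
      have bT : 0 <= b' + 2 * c * T by rewrite addr_ge0// mulr_ge0// mulr_ge0.
      have K0 : 0 <= K by rewrite mulr_ge0// ltW.
      have K1 : 0 < K + 1 by lra.
      exists (eps / (K + 1)) => [|s ts std sT]; first by rewrite divr_gt0.
      have s0 : 0 <= s by lra.
      have st : 0 < s - t by rewrite subr_gt0.
      have hd : (K + 1) * (s - t) <= eps by rewrite mulrC -ler_pdivlMr//; lra.
      have h1 := Pinc t s t0 (ltW ts).
      set E := expR (- l * t) in h1 *; set F := expR (- l * s).
      have /andP[d1 d2] := expR_decay_lipschitz (ltW l0) t0 (ltW ts).
      rewrite -/E -/F in d1 d2.
      have h2 : (E - F) * G s <= (E - F) * (A s - (b' + 2 * c * s) / l).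
        apply: ler_wpM2l => //; rewrite AP; have := Gle s s0; rewrite -/(G s); lra.
      have Ast : A s - A t <= (s - t) * (b' + 2 * c * s).
        have -> : A s - A t = (s - t) * (b' + c * (s + t)) by rewrite /A; ring.
        by rewrite ler_pM2l// lerD2l [2 * c]mulrC -mulrA ler_wpM2l//; lra.
      have E0 : 0 < E by exact: expR_gt0.
      have F0 : 0 < F by exact: expR_gt0.
      have E1 : E <= 1 by rewrite -expR0 ler_expR mulNr oppr_le0 mulr_ge0// ltW.
      (* E - F >= F l (s - t) since E = F e^{l (s - t)} *)
      have EF : F * (l * (s - t)) <= E - F.
        have -> : E = F * expR (l * (s - t)) by rewrite /E /F -expRD; congr expR; ring.
        have := expR_ge1Dx (l * (s - t)); rewrite -(ler_pM2l F0); lra.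
      have bs0 : 0 <= b' + 2 * c * s by rewrite addr_ge0// mulr_ge0// mulr_ge0.
      have bsT : b' + 2 * c * s <= b' + 2 * c * T
        by rewrite lerD2l ler_wpM2l// mulr_ge0.
      have h3 : E * (A s - A t) <= E * ((s - t) * (b' + 2 * c * s)) by rewrite ler_pM2l.
      have h4 : F * (s - t) * (b' + 2 * c * s) <= (E - F) * ((b' + 2 * c * s) / l).
        rewrite mulrA ler_pdivlMr//; have := ler_wpM2r bs0 EF; lra.
      have h5 : (E - F) * ((s - t) * (b' + 2 * c * s)) <= eps * (s - t).
        apply: (@le_trans _ _ (l * (s - t) * ((s - t) * (b' + 2 * c * T)))).
          apply: ler_pM => //; first by rewrite mulr_ge0// ltW.
          by rewrite ler_pM2l.
        have -> : l * (s - t) * ((s - t) * (b' + 2 * c * T)) = K * (s - t) * (s - t).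
          by rewrite /K; ring.
        rewrite ler_pM2r//; lra.
      rewrite /psi -/E -/F; lra.
  have FT : 0 <= expR (- l * T) * A T by rewrite mulr_ge0 ?expR_ge0// A0.
  have GT : expR (- l * T) * G T <= expR (- l * T) * T.
    by rewrite ler_wpM2l ?expR_ge0//; case/andP: (Gle_id T T0).
  have P0 : P 0 = 0 by exact: cumulated0.
  move: main; rewrite /psi P0 G0 !mulr0 expR0 /A !mulr0 expr0n/= !mulr0 -/(A T); lra.
apply/ler_addgt0Pr => e e0.
have [x x0 xe] := expR_neg_tail e0.
pose T := x / l.
have T0 : 0 <= T by rewrite divr_ge0 ?(ltW x0) ?(ltW l0).
have lT : l * T = x by rewrite /T mulrC divfK ?gt_eqF.
rewrite (discounted_split l0 rh T0) -/(P T).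
have d1 := discounted_le1 l0 (cost_rate_shift T0 rh).
have E0 := expR_gt0 (- l * T).
have h1 : expR (- l * T) * discounted l (fun r => h (T + r)) <= expR (- l * T)
  by rewrite ler_piMr// ltW.
have h2 := ler_wpM2l (ltW l0) (fin T T0).
have h3 : l * (expR (- l * T) * T + a') = expR (- l * T) * x + l * a' by rewrite -lT;
  ring.
have h4 : l * a' = a * l + b + 2 * c / l by rewrite /a' /b'; field; rewrite gt_eqF.
move: xe; rewrite -lT -mulNr lT; lra.
Qed.

(** This is the upper bound for the cost rate [1 - h]. *)
Lemma discounted_ge_affine l h (a b : R) : 0 < l -> cost_rate h -> 0 <= a -> b <= 1 ->
  (forall s : R, 0 <= s -> b * s - a <= cumulated h s) -> b - a * l <= discounted l h.
Proof.
move=> l0 rh a0 b1 Gge.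
have := @discounted_le_poly l _ a (1 - b) 0 l0 (cost_rate_onem rh) a0 _ (lexx 0) _.
rewrite discounted_onem// mulr0 mul0r addr0 subr_ge0 b1 => /(_ isT) bound.
suff : 1 - discounted l h <= a * l + (1 - b) by lra.
apply: bound => s s0; rewrite cumulated_onem// mul0r; have := Gge s s0; lra.
Qed.

End Comparison.

(** * The Tauberian theorem for families of costs closed under splicing *)

Section Tauberian.
Context {R : realType} {X : Type}.
Variable H : X -> set (R -> R).
Variable V : X -> R.

Definition splice (s : R) (h1 h2 : R -> R) : R -> R :=
  fun r => if r < s then h1 r else h2 (r - s).

Hypothesis H_nonempty : forall x, H x !=set0.
Hypothesis H_rate : forall x h, H x h -> cost_rate h.
Hypothesis H_splice : forall x h s, H x h -> 0 <= s ->
  exists x', H x' (fun r => h (s + r)) /\ forall h2, H x' h2 -> H x (splice s h h2).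

(** Closeness of an infimum of costs to [V x], said of the costs themselves. *)
Definition horizon_close (e t : R) (x : X) : Prop :=
  (forall h, H x h -> t * (V x - e) <= cumulated h t) /\
  (exists2 h, H x h & cumulated h t <= t * (V x + e)).

Definition discount_close (e l : R) (x : X) : Prop :=
  (forall h, H x h -> V x - e <= discounted l h) /\
  (exists2 h, H x h & discounted l h <= V x + e).

Definition horizon_uniform := forall e, 0 < e -> exists2 S, 0 < S &
  forall t x, S <= t -> horizon_close e t x.

Definition discount_uniform := forall e, 0 < e -> exists2 L, 0 < L &
  forall l x, 0 < l -> l <= L -> discount_close e l x.

Lemma cumulated_bounds (h : R -> R) (t : R) : cost_rate h -> 0 <= t ->
  0 <= cumulated h t <= t.
Proof.
by move=> rh t0; have := cumulated_increment rh (lexx 0) t0; rewrite cumulated0 !subr0.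
Qed.

Lemma splice_cumulated (s : R) (h1 h2 : R -> R) (t : R) : 0 <= s -> 0 <= t ->
  cost_rate (splice s h1 h2) ->
  cumulated (splice s h1 h2) (s + t) <= s + cumulated h2 t.
Proof.
move=> s0 t0 rs; rewrite -lerBlDl.
have -> : cumulated h2 t = cumulated (fun r => splice s h1 h2 (s + r)) t.
  apply: eq_Rintegral => r; rewrite inE/= in_itv/= => /andP[r0 _].
  by rewrite /splice gtrDl ltNge r0/= addrAC subrr add0r.
rewrite (cumulated_shift rs s0 t0) lerD2l lerN2.
by case/andP: (cumulated_bounds rs s0).
Qed.

Lemma splice_discounted (l s : R) (h1 h2 : R -> R) : 0 < l -> 0 <= s ->
  cost_rate h2 -> cost_rate (splice s h1 h2) ->
  discounted l (splice s h1 h2) <= l * s + discounted l h2.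
Proof.
move=> l0 s0 r2 rs; rewrite (discounted_split l0 rs s0).
have -> : discounted l (fun r => splice s h1 h2 (s + r)) = discounted l h2.
  congr (_ * _); apply: eq_Rintegral => r; rewrite inE/= in_itv/= andbT => r0.
  by rewrite /splice gtrDl ltNge r0/= addrAC subrr add0r.
apply: lerD.
  by rewrite ler_pM2l//; case/andP: (cumulated_bounds (discounted_rate l0 rs) s0).
apply: ler_piMl; first exact: discounted_ge0.
by rewrite -expR0 ler_expR mulNr oppr_le0 mulr_ge0// ltW.
Qed.

Section FromHorizon.
Hypothesis cvgT : horizon_uniform.

Lemma horizon_limit_bounds x : 0 <= V x <= 1.
Proof.
have key e : 0 < e -> 0 <= V x + e /\ V x <= 1 + e.
  move=> e0; have [S S0 /(_ S x (lexx S))[low [h Hh up]]] := cvgT e0.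
  have := low h Hh; have /andP[] := cumulated_bounds (H_rate Hh) (ltW S0).
  move: (cumulated h S) up => c up c0 cS lo.
  split; first by rewrite -(pmulr_rge0 _ S0); exact: le_trans up.
  by rewrite -lerBlDr -(ler_pM2l S0) mulr1; exact: le_trans cS.
by apply/andP; split; apply/ler_addgt0Pr => e /key[].
Qed.

(** Following [h] up to time [s], then an almost optimal rate from [x'], costs at
    most [s] more than the latter, which is negligible for long horizons. *)
Lemma horizon_limit_nondecreasing x h s : H x h -> 0 <= s ->
  exists2 x', H x' (fun r => h (s + r)) & V x <= V x'.
Proof.
move=> Hh s0; have [x' [Hx' Hs]] := H_splice Hh s0.
exists x' => //; apply/ler_addgt0Pr => e e0.
have [d d0 dE] : exists2 d, 0 < d & 3 * d = e
  by exists (e / 3); [rewrite divr_gt0|field].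
have [S S0 SP] := cvgT d0.
have [T [ST sdT]] : exists T, S <= T /\ s <= d * T.
  exists (S + s / d); rewrite lerDl divr_ge0 ?(ltW d0)//; split => //.
  rewrite mulrDr [d * (s / d)]mulrC divfK ?gt_eqF// lerDr.
  by apply: mulr_ge0; exact: ltW.
have T0 : 0 < T by exact: lt_le_trans ST.
have [_ [h2 Hh2 near2]] := SP T x' ST.
have STs : S <= s + T by apply: le_trans ST _; rewrite lerDr.
have [/(_ _ (Hs _ Hh2)) low _] := SP (s + T) x STs.
have /(le_trans low) := splice_cumulated s0 (ltW T0) (H_rate (Hs _ Hh2)).
have /andP[v0 _] := horizon_limit_bounds x'.
move: (cumulated h2 T) (V x) (V x') near2 v0 => c v v' near2 v0 fin.
have sv : 0 <= s * v' by rewrite mulr_ge0.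
have sd : 0 <= s * d by rewrite mulr_ge0// ltW.
rewrite -(ler_pM2l (ltr_wpDl s0 T0 : 0 < s + T)) -dE; clear - near2 fin sdT sv sd; lra.
Qed.

(** The lower estimate needs no choice; for the upper one the horizon [t] of the
    almost optimal rate is a large multiple of the mean discount time [1 / l]. *)
Lemma horizon_uniform_discount : discount_uniform.
Proof.
move=> e e0.
(* [M] is the ratio of the horizon to the mean discount time: what happens after
   the horizon contributes [2 / M]; the error [d] per unit of time is multiplied
   by [M]. *)
have [M M0 Me] : exists2 M, 0 < M & M * e = 8.
  by exists (8 / e); rewrite ?divr_gt0// divfK ?gt_eqF.
have M1 : 0 < 16 * (M + 1) by lra.
have [d d0 dM] : exists2 d, 0 < d & d * (16 * (M + 1)) = e.
  by exists (e / (16 * (M + 1))); rewrite ?divr_gt0// divfK ?gt_eqF.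
have dM0 : 0 <= d * M by rewrite mulr_ge0 ?ltW.
have [S S0 SP] := cvgT d0.
have [c c0 ec] : exists2 c, 0 < c & 4 * c = e
  by exists (e / 4); [rewrite divr_gt0|field].
exists (Num.min (M / S) (c / S)) => [|l x l0]; first by rewrite lt_min !divr_gt0.
rewrite le_min !ler_pdivlMr// => /andP[lS1 lS2].
have /andP[v0 v1] := horizon_limit_bounds x.
split=> [h Hh|].
  have rh := H_rate Hh.
  have bnd s : 0 <= s -> (V x - d) * s - S <= cumulated h s.
    move=> s0; have /andP[c1 _] := cumulated_bounds rh s0.
    have [sS|Ss] := ltP s S.
      apply: le_trans c1; rewrite subr_le0; apply: le_trans (ltW sS).
      by apply: ler_piMl => //; clear - v1 d0; lra.
    have [/(_ _ Hh) low _] := SP s x Ss.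
    by rewrite mulrC; apply: le_trans low; rewrite gerBl ltW.
  have vd1 : V x - d <= 1 by clear - v1 d0; lra.
  apply: le_trans (discounted_ge_affine l0 rh (ltW S0) vd1 bnd).
  clear - lS2 ec dM dM0 d0 e0; lra.
have [t t0 lt] : exists2 t, 0 < t & l * t = M.
  by exists (M / l); rewrite ?divr_gt0// mulrC divfK ?gt_eqF.
have St : S <= t by rewrite -(ler_pM2l l0) lt.
have [_ [h Hh top]] := SP t x St; have rh := H_rate Hh; exists h => //.
have dt0 : 0 <= d * t by rewrite mulr_ge0// ltW.
have bnd s : 0 <= s -> cumulated h s <= (S + 2 * (d * t)) + V x * s + t^-1 * s ^+ 2.
  move=> s0; have /andP[_ cs] := cumulated_bounds rh s0.
  have p1 : 0 <= t^-1 * s ^+ 2 by rewrite mulr_ge0 ?sqr_ge0// invr_ge0 ltW.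
  have p2 : 0 <= V x * s by rewrite mulr_ge0.
  have [ts|st] := leP t s.
    have : s <= t^-1 * s ^+ 2 by rewrite expr2 mulrA ler_peMl// mulrC ler_pdivlMr// mul1r.
    by move: cs p2; clear - S0 dt0; lra.
  have r0 : 0 <= t - s by rewrite subr_ge0 ltW.
  have [rS|Sr] := ltP (t - s) S.
    have /andP[h1 _] := cumulated_increment rh s0 (ltW st).
    have h2 : V x * (t - s) <= t - s by rewrite ler_piMl.
    by move: h1 h2 top p1; clear - dt0 rS; lra.
  have [x' Hx' Vx'] := horizon_limit_nondecreasing Hh s0.
  have [/(_ _ Hx') + _] := SP (t - s) x' Sr.
  rewrite (cumulated_shift rh s0 r0) subrKC => low.
  have h2 : (t - s) * (V x - d) <= (t - s) * (V x' - d) by rewrite ler_wpM2l// lerD2r.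
  have h3 : 0 <= d * s by rewrite mulr_ge0// ltW.
  by move: (le_trans h2 low) top p1; clear - h3 S0; lra.
have SdT : 0 <= S + 2 * (d * t) by rewrite addr_ge0 ?(ltW S0)// mulr_ge0.
have it : 0 <= t^-1 by rewrite invr_ge0 ltW.
apply: le_trans (discounted_le_poly l0 rh SdT v0 it bnd) _.
have h3 : 2 * t^-1 / l = c.
  have cM : 4 * (c * M) = M * e by rewrite -ec; ring.
  have {}cM : 2 = c * M by move: cM; rewrite Me; clear - v0; lra.
  by rewrite -mulrA -invfM [t * l]mulrC lt cM mulfK ?gt_eqF.
have h4 : (S + 2 * (d * t)) * l = l * S + 2 * (d * M) by rewrite -lt; ring.
rewrite h3 h4; clear - lS2 ec dM dM0 d0 e0; lra.
Qed.

End FromHorizon.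

Section FromDiscount.
Hypothesis cvgD : discount_uniform.

Lemma discount_limit_bounds x : 0 <= V x <= 1.
Proof.
have key e : 0 < e -> 0 <= V x + e /\ V x <= 1 + e.
  move=> e0; have [L L0 /(_ L x L0 (lexx L))[low [h Hh up]]] := cvgD e0.
  split; first exact: le_trans (discounted_ge0 L0 (H_rate Hh)) up.
  by rewrite -lerBlDr; exact: le_trans (low h Hh) (discounted_le1 L0 (H_rate Hh)).
by apply/andP; split; apply/ler_addgt0Pr => e /key[].
Qed.

Lemma discount_limit_nondecreasing x h s : H x h -> 0 <= s ->
  exists2 x', H x' (fun r => h (s + r)) & V x <= V x'.
Proof.
move=> Hh s0; have [x' [Hx' Hs]] := H_splice Hh s0.
exists x' => //; apply/ler_addgt0Pr => e e0.
have [d d0 dE] : exists2 d, 0 < d & 3 * d = e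
  by exists (e / 3); [rewrite divr_gt0|field].
have [L L0 LP] := cvgD d0.
have s1 : 0 < s + 1 by rewrite ltr_wpDl.
have [l [l0 lL ls]] : exists l, [/\ 0 < l, l <= L & l * (s + 1) <= d].
  exists (Num.min L (d / (s + 1))); rewrite lt_min L0 divr_gt0// ge_min lexx;
    split => //.
  by rewrite -ler_pdivlMr// ge_min lexx orbT.
have [_ [h2 Hh2 near2]] := LP l x' l0 lL.
have [/(_ _ (Hs _ Hh2)) low _] := LP l x l0 lL.
have /(le_trans low) := splice_discounted l0 s0 (H_rate Hh2) (H_rate (Hs _ Hh2)).
move: (discounted l h2) near2 => c near2; clear - near2 ls l0 dE; lra.
Qed.

(** Both estimates rely on [V] not decreasing along trajectories: the upper one
    for a rate [l] with [l t] small, the lower one for [l t] large. *)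
Lemma discount_uniform_horizon : horizon_uniform.
Proof.
move=> e; wlog e1 : e / e <= 1 => [wl e0|e0].
  have m0 : 0 < Num.min e 1 by rewrite lt_min e0 ltr01.
  have [|S S0 SP] := wl _ _ m0; first by rewrite ge_min lexx orbT.
  exists S => // t x St; have [low [h Hh up]] := SP t x St.
  have t0 : 0 <= t by apply: le_trans St; exact: ltW.
  split=> [h' Hh'|]; [apply: le_trans (low _ Hh')|exists h => //; apply: le_trans up _].
    by rewrite ler_wpM2l// lerD2l lerN2 ge_min lexx.
  by rewrite ler_wpM2l// lerD2l ge_min lexx.
have [tau tau0 tauE] : exists2 tau, 0 < tau & 4 * tau = e
  by exists (e / 4); [rewrite divr_gt0|field].
have [d d0 dE] : exists2 d, 0 < d & 8 * d = e * tau.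
  by exists (e * tau / 8); [rewrite divr_gt0// mulr_gt0|field].
have [b b0 bE] : exists2 b, 0 < b & 8 * b = e
  by exists (e / 8); [rewrite divr_gt0|field].
have [L1 L10 LP1] := cvgD d0.
have [L2 L20 LP2] := cvgD b0.
have [C C0 CE] : exists2 C, 0 < C & C * (e * e) = 64.
  by exists (64 / (e * e)); rewrite ?divr_gt0 ?mulr_gt0// divfK// mulf_neq0 ?gt_eqF.
exists (tau / L1 + C / L2) => [|t x tS]; first by rewrite addr_gt0// divr_gt0.
have t1 : tau / L1 <= t by apply: le_trans tS; rewrite lerDl divr_ge0// ltW.
have t2 : C / L2 <= t by apply: le_trans tS; rewrite lerDr divr_ge0// ltW.
have t0 : 0 < t by apply: lt_le_trans t1; rewrite divr_gt0.
have /andP[v0 v1] := discount_limit_bounds x.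
split=> [h Hh|].
  have rh := H_rate Hh; have /andP[c0 _] := cumulated_bounds rh (ltW t0).
  rewrite leNgt; apply/negP => bad.
  have [l l0 lt] : exists2 l, 0 < l & l * t = C.
    by exists (C / t); rewrite ?divr_gt0// divfK ?gt_eqF.
  have lL : l <= L2 by rewrite -(ler_pM2r t0) lt mulrC -ler_pdivrMr.
  have Ve : 0 < V x - e by rewrite -(pmulr_rgt0 _ t0); exact: le_lt_trans bad.
  have [p pE] : exists p, p = V x - 4 * b by eexists.
  have p0 : 0 <= p by move: Ve; clear - pE bE b0; lra.
  have p1 : p <= 1 by clear - pE v1 b0; lra.
  have [eta eta0 etaE] : exists2 eta, 0 < eta & eta * l = b.
    by exists (b / l); rewrite ?divr_gt0// divfK ?gt_eqF.
  have eta_t : 4 * eta <= t * e.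
    rewrite -(ler_pM2r l0) -mulrA etaE mulrAC [t * l]mulrC lt.
    rewrite -(ler_pM2r e0) -[C * e * e]mulrA CE; clear - e0 e1 b0 bE; nra.
  (* an almost maximal value of [F]: the averages taken from there are below [p] *)
  pose F s := cumulated h s - p * s.
  pose I := [set F s | s in `[0, t]%classic].
  have supI : has_sup I.
    split; first by exists (F 0), 0 => //=; rewrite in_itv/= lexx ltW.
    exists t => _ [s /= + <-]; rewrite in_itv/= => /andP[s0 st].
    have /andP[_ cs] := cumulated_bounds rh s0.
    by rewrite /F lerBlDr; apply: le_trans cs _; apply: le_trans st _;
      rewrite lerDl mulr_ge0.
  have [_ [s /= + <-] sF] := sup_adherent eta0 supI.
  rewrite in_itv/= => /andP[s0 st].
  have almost_max r : 0 <= r -> r <= t -> F r <= F s + eta.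
    move=> r0 rt; rewrite -lerBlDr; apply: ltW; apply: le_lt_trans sF.
    by rewrite lerD2r; apply: ub_le_sup; [case: supI|exists r => //=;
      rewrite in_itv/= r0].
  (* [F] is at least [- eta] at [s], at most [- t e / 2] at [t], and its slope is at
     least [- 1]: hence [t - s] is at least of order [t e] *)
  have [beta beta0 betaE] : exists2 beta, 0 < beta & 4 * beta = t * e.
    by exists (t * e / 4); [rewrite divr_gt0// mulr_gt0|field].
  have bts : beta <= t - s.
    have := almost_max 0 (lexx 0) (ltW t0).
    have /andP[+ _] := cumulated_increment rh s0 st.
    rewrite /F cumulated0 mulr0 subr0.
    have pts : p * (t - s) <= t - s by rewrite ler_piMl// subr_ge0.
    have tb : 8 * (t * b) = t * e by rewrite -bE; ring.
    have tp : p * t = t * V x - 4 * (t * b) by rewrite pE; ring.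
    rewrite [t * (_ - _)]mulrBr in bad; rewrite mulrBr in pts.
    move: (cumulated h s) (cumulated h t) bad => cs ct bad cst maxs.
    by clear - bad cst maxs pts tb tp eta_t betaE; lra.
  have [x' Hx' Vx'] := discount_limit_nondecreasing Hh s0.
  have bnd r : 0 <= r -> cumulated (fun r => h (s + r)) r <= eta + p * r + beta^-1 * r ^+ 2.
    move=> r0; have pr : 0 <= p * r by rewrite mulr_ge0.
    have rr : 0 <= beta^-1 * r ^+ 2 by rewrite mulr_ge0 ?sqr_ge0// invr_ge0 ltW.
    have [rb|br] := leP r beta.
      rewrite cumulated_shift//.
      have := almost_max (s + r) (addr_ge0 s0 r0) _;
        rewrite -lerBrDl => /(_ (le_trans rb bts)).
      by rewrite /F; clear - rr; lra.
    have /andP[_ cr] := cumulated_bounds (H_rate Hx') r0.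
    have : r <= beta^-1 * r ^+ 2
      by rewrite expr2 mulrA ler_peMl// mulrC ler_pdivlMr// mul1r ltW.
    by move: cr; clear - eta0 pr; lra.
  have ib : 0 <= beta^-1 by rewrite invr_ge0 ltW.
  have := discounted_le_poly l0 (H_rate Hx') (ltW eta0) p0 ib bnd.
  have [/(_ _ Hx') low _] := LP2 l x' l0 lL.
  move/(le_trans low).
  have -> : 2 * beta^-1 / l = b.
    have bbl : 32 * (b * (beta * l)) = C * (e * e).
      have -> : 32 * (b * (beta * l)) = 8 * b * (4 * beta) * l by ring.
      by rewrite bE betaE -lt; ring.
    have {}bbl : 2 = b * (beta * l) by move: bbl; rewrite CE; clear - v0; lra.
    by rewrite -mulrA -invfM bbl mulfK// mulf_neq0 ?gt_eqF.
  by rewrite etaE pE; clear - Vx' b0; lra.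
(* the weights [exp(- l s)] vary by at most [tau] before [t] *)
have [l l0 lt] : exists2 l, 0 < l & l * t = tau.
  by exists (tau / t); rewrite ?divr_gt0// divfK ?gt_eqF.
have lL : l <= L1 by rewrite -(ler_pM2r t0) lt mulrC -ler_pdivrMr.
have [_ [h Hh hnear]] := LP1 l x l0 lL; have rh := H_rate Hh; exists h => //.
have [x' Hx' Vx'] := discount_limit_nondecreasing Hh (ltW t0).
have [/(_ _ Hx') low _] := LP1 l x' l0 lL.
have split_t := discounted_split l0 rh (ltW t0).
have wgt := cumulated_discount_ge l0 rh (ltW t0).
have lltau : - l * t = - tau by rewrite mulNr lt.
rewrite lltau in split_t wgt.
have E1 : expR (- tau) <= 1 by rewrite -expR0 ler_expR oppr_le0 ltW.
have E2 : 1 - tau <= expR (- tau) by exact: expR_ge1Dx.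
have E0 := expR_gt0 (- tau).
have /andP[c0 ct] := cumulated_bounds rh (ltW t0).
move: (expR (- tau)) (cumulated h t) (discounted l (fun r => h (t + r)))
  (cumulated (fun s : R => expR (- l * s) * h s) t) (discounted l h) (V x) (V x')
  E0 E1 E2 c0 ct split_t wgt low hnear v0 v1 Vx' => E c D P D0 v v'.
move=> E0 E1 E2 c0 ct -> wgt low hnear v0 v1 vv'.
have h5 : E * (v - d) <= E * D by rewrite ler_pM2l//; lra.
have h6 : l * (E * c) <= l * P by rewrite ler_pM2l.
have Ed : E * d <= d by rewrite ler_piMl// ltW.
have h9 : v * (1 - E) <= v * tau by rewrite ler_wpM2l//; lra.
have h10 : l * (E * c) <= v * tau + 3 * d by lra.
have h11 : l * ((1 - E) * c) <= tau * tau.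
  rewrite mulrCA -lt; apply: ler_pM; [lra|by rewrite mulr_ge0// ltW|rewrite lt; lra|].
  by rewrite ler_pM2l.
have h12 : l * c <= v * tau + 3 * d + tau * tau by lra.
rewrite -(ler_pM2l l0) mulrA lt; apply: le_trans h12 _.
have tt : 0 <= tau * tau by rewrite mulr_ge0// ltW.
by nra.
Qed.

End FromDiscount.
End Tauberian.

(** * Value functions of the control problem *)

Section UniformConvergence.
Context {R : realType} {T : choiceType}.
Implicit Types (V : T -> R) (F : R -> T -> R).

Lemma uniform_cvg_distP (G : set_system (T -> R)) (V : T -> R) : Filter G ->
  {uniform, G --> V} <->
  forall e, 0 < e -> G [set h | forall x, `|V x - h x| <= e].
Proof.
move=> FG; split=> [GV e e0|GV P /uniform_nbhs[E [entE EP]]].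
  apply: GV; apply/uniform_nbhs.
  exists [set xy : R * R | ball xy.1 e xy.2]; split; first
    by rewrite -entourage_ballE; exists e.
  by move=> h hb x; apply: ltW; exact: hb.
move: entE; rewrite -entourage_ballE => -[e /= e0 eE].
have e2 : 0 < e / 2 by rewrite divr_gt0.
apply: filterS (GV _ e2) => h hV; apply: EP => x _; apply: eE => /=.
by rewrite /ball/=; apply: le_lt_trans (hV x) _; lra.
Qed.

Lemma uniform_cvg_pinfty F V : {uniform, F t @[t --> +oo] --> V} <->
  forall e, 0 < e -> exists2 S, 0 < S & forall t, S <= t ->
    forall x, `|V x - F t x| <= e.
Proof.
rewrite uniform_cvg_distP; split=> FV e e0; last first.
  have [S S0 SP] := FV e e0.
  by exists S; split=> [|t /ltW St]; [exact: num_real|exact: SP].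
have [M [_ MP]] := FV e e0.
exists (`|M| + 1) => [|t Mt]; first by rewrite ltr_wpDl.
by apply: MP; apply: lt_le_trans Mt; rewrite ltr_pwDr// ler_norm.
Qed.

Lemma uniform_cvg_at_right0 F V : {uniform, F l @[l --> 0^'+] --> V} <->
  forall e, 0 < e -> exists2 L, 0 < L &
    forall l, 0 < l -> l <= L -> forall x, `|V x - F l x| <= e.
Proof.
rewrite uniform_cvg_distP; split=> FV e e0; last first.
  have [L L0 LP] := FV e e0.
  exists L => //= l; rewrite /ball/= sub0r normrN => lL l0.
  by apply: LP => //; apply: le_trans (ltW lL); exact: ler_norm.
have [d /= d0 dP] := FV e e0.
exists (d / 2) => [|l l0 ld]; first by rewrite divr_gt0.
by apply: dP => //; rewrite /ball/= sub0r normrN gtr0_norm//; lra.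
Qed.

Lemma inf_dist_le (I : Type) (A : set I) (c : I -> R) (v e : R) :
  (forall a, A a -> v - e <= c a) -> (exists2 a, A a & c a <= v + e) ->
  `|v - inf [set c a | a in A]| <= e.
Proof.
move=> lo [a Aa up].
have lb : lbound [set c a | a in A] (v - e) by move=> _ [b Ab <-]; exact: lo.
have h1 : v - e <= inf [set c a | a in A] by apply: lb_le_inf => //; exists (c a), a.
have h2 : inf [set c a | a in A] <= c a by apply: ge_inf; [exists (v - e)|exists a].
by rewrite ler_norml; lra.
Qed.

Lemma dist_inf_le (I : Type) (A : set I) (c : I -> R) (v e : R) : 0 < e ->
  A !=set0 -> (forall a, A a -> 0 <= c a) -> `|v - inf [set c a | a in A]| <= e / 2 ->
  (forall a, A a -> v - e <= c a) /\ (exists2 a, A a & c a <= v + e).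
Proof.
move=> e0 [a0 Aa0] c0; rewrite ler_norml => /andP[h1 h2].
have infA : has_inf [set c a | a in A].
  by split; [exists (c a0), a0|exists 0 => _ [a Aa <-]; exact: c0].
have e2 : 0 < e / 2 by rewrite divr_gt0.
split=> [a Aa|].
  have : inf [set c a | a in A] <= c a by apply: ge_inf; [case: infA|exists a].
  lra.
by have [_ [a Aa <-] ca] := inf_adherent e2 infA; exists a => //; lra.
Qed.

End UniformConvergence.

Section Costs.
Context {R : realType} {n : nat} {U : metricType R}.
Variables (f : 'rV[R]_n -> U -> 'rV[R]_n) (g : 'rV[R]_n * U -> R).
Hypothesis f_lip : state_lipschitz f.
Hypothesis f_cont : forall y : 'rV[R]_n, continuous (f y).
Hypothesis f_growth : linear_growth f.
Hypothesis g01 : forall z : 'rV[R]_n * U, 0 <= g z <= 1.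
Hypothesis g_borel : borel_measurable g.

(** The rates are only prescribed on the half-line, which makes the set stable
    under shifts and splices whatever the conventions at negative times. *)
Definition costs (y0 : 'rV[R]_n) : set (R -> R) :=
  [set h | exists2 u, controls u & forall s, 0 <= s -> h s = running_cost f g y0 u s].

Lemma costs_rate y0 h : costs y0 h -> cost_rate h.
Proof.
move=> [u mu_ hE]; split; last by move=> s s0; rewrite hE//; exact: g01.
have [_ _ [y cy yE]] := trajectoryP f_lip f_cont f_growth y0 mu_.
apply: eq_measurable_fun (measurable_fun_state_control mu_ cy g_borel) => s.
by rewrite inE/= in_itv/= andbT => s0; rewrite hE// /running_cost yE.
Qed.

(** The control [u] is the concatenation of itself with its own shift, so both the
    shift and the splice follow from the concatenation of trajectories. *)
Lemma costs_splice y0 h s : costs y0 h -> 0 <= s ->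
  exists y1, costs y1 (fun r => h (s + r)) /\
    forall h2, costs y1 h2 -> costs y0 (splice s h h2).
Proof.
move=> [u mu_ hE] s0.
pose v (r : R) := u (s + r).
have mv : controls v.
  move=> A bA.
  have -> : `[0, +oo[ `&` v @^-1` A = `[0, +oo[ `&`
      ((fun r : R => r + s) @^-1` (`[0, +oo[ `&` u @^-1` A)).
    apply/seteqP; split => r /=; rewrite !in_itv/= !andbT /v [s + r]addrC.
      by move=> [r0 Ar]; rewrite addr_ge0.
    by move=> [r0 [_ Ar]].
  apply: measurableI; first exact: measurable_line_itv.
  by apply: measurable_translate; exact: mu_.
have uE : concat_control s u v = u.
  by apply/funext => r; rewrite /concat_control /v subrKC; case: ifP.
exists (trajectory f u y0 s); split.
  exists v => // r r0; rewrite hE ?addr_ge0// /running_cost.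
  have [_ /(_ r r0)] := trajectory_concat f_lip f_cont f_growth y0 mu_ mv s0.
  by rewrite uE => ->.
move=> h2 [w mw h2E]; exists (concat_control s u w); first exact: controls_concat.
have [left right] := trajectory_concat f_lip f_cont f_growth y0 mu_ mw s0.
move=> r r0; rewrite /splice /running_cost /concat_control; case: ltP => rs.
  by rewrite hE// /running_cost left// ltW.
have rs0 : 0 <= r - s by rewrite subr_ge0.
by rewrite h2E// /running_cost -right// subrKC.
Qed.

Lemma value_horizonE t y0 :
  value_horizon f g t y0 = inf [set t^-1 * cumulated h t | h in costs y0].
Proof.
congr inf; apply/seteqP; split => z [].
  by move=> u mu_ <-; exists (running_cost f g y0 u) => //; exists u.
move=> h [u mu_ hE] <-; exists u => //; congr (_ * _); apply: eq_Rintegral => s.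
by rewrite inE/= in_itv/= => /andP[s0 _]; rewrite hE.
Qed.

Lemma value_discountedE l y0 :
  value_discounted f g l y0 = inf [set discounted l h | h in costs y0].
Proof.
congr inf; apply/seteqP; split => z [].
  by move=> u mu_ <-; exists (running_cost f g y0 u) => //; exists u.
move=> h [u mu_ hE] <-; exists u => //; congr (_ * _); apply: eq_Rintegral => s.
by rewrite inE/= in_itv/= andbT => s0; rewrite hE.
Qed.

Hypothesis U_nonempty : [set: U] !=set0.

Lemma costs_nonempty y0 : costs y0 !=set0.
Proof.
have [v _] := U_nonempty; exists (running_cost f g y0 (fun=> v)).
by exists (fun=> v) => //; exact: controls_cst.
Qed.

Lemma value_horizon_uniformP (V : 'rV[R]_n -> R) :
  {uniform, value_horizon f g t @[t --> +oo] --> V} <-> horizon_uniform costs V.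
Proof.
rewrite uniform_cvg_pinfty; split=> cvgV e e0.
  have [S S0 SP] := cvgV _ (divr_gt0 e0 (ltr0Sn _ 1)); exists S => // t x St.
  have t0 : 0 < t by exact: lt_le_trans St.
  have := SP t St x; rewrite value_horizonE => /(dist_inf_le e0 (costs_nonempty x))[].
    move=> h Hh; rewrite mulr_ge0 ?invr_ge0 ?(ltW t0)//.
    by case/andP: (cumulated_bounds (costs_rate Hh) (ltW t0)).
  move=> lo [h Hh up]; split; last by exists h => //; rewrite -ler_pdivrMl.
  by move=> h' /lo; rewrite ler_pdivlMl.
have [S S0 SP] := cvgV e e0; exists S => // t St x.
have t0 : 0 < t by exact: lt_le_trans St.
have [lo [h Hh up]] := SP t x St; rewrite value_horizonE; apply: inf_dist_le.
  by move=> h' /lo; rewrite ler_pdivlMl.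
by exists h => //; rewrite ler_pdivrMl.
Qed.

Lemma value_discounted_uniformP (V : 'rV[R]_n -> R) :
  {uniform, value_discounted f g l @[l --> 0^'+] --> V} <-> discount_uniform costs V.
Proof.
rewrite uniform_cvg_at_right0; split=> cvgV e e0.
  have [L L0 LP] := cvgV _ (divr_gt0 e0 (ltr0Sn _ 1)); exists L => // l x l0 lL.
  have := LP l l0 lL x; rewrite value_discountedE => /(dist_inf_le e0 (costs_nonempty x))[].
    by move=> h Hh; apply: discounted_ge0 => //; exact: costs_rate Hh.
  by move=> lo up; split.
have [L L0 LP] := cvgV e e0; exists L => // l l0 lL x.
have [lo up] := LP l x l0 lL; rewrite value_discountedE; exact: inf_dist_le.
Qed.

End Costs.

Theorem theorem5 (R : realType) (n : nat) (U : metricType R)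
    (f : 'rV[R]_n -> U -> 'rV[R]_n) (g : 'rV[R]_n * U -> R)
    (V : 'rV[R]_n -> R) :
  [set: U] !=set0 ->
  state_lipschitz f ->
  (forall y : 'rV[R]_n, continuous (f y)) ->
  linear_growth f ->
  (forall z : 'rV[R]_n * U, 0 <= g z <= 1) ->
  borel_measurable g ->
  {uniform, value_horizon f g t @[t --> +oo] --> V} <->
  {uniform, value_discounted f g lambda @[lambda --> 0^'+] --> V}.
Proof.
move=> U0 f_lip f_cont f_growth g01 g_borel.
have rate := costs_rate f_lip f_cont f_growth g01 g_borel.
have glue := costs_splice f_lip f_cont f_growth (g := g).
rewrite value_horizon_uniformP// value_discounted_uniformP//; split.
  exact: horizon_uniform_discount.
exact: discount_uniform_horizon.
Qed.
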